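(* Let $v,a,b,c\in\mathbb{C}$ with $a\neq0$, $b\neq0$, $\Re(v)<4$, $\Re(c)>0$, and $\Re(vc+a+b)>0$, $\Re(vc+a-b)>0$, $\Re(vc-a+b)>0$, $\Re(vc-a-b)>0$. Put $\sigma_3=\frac v2-\frac{a}{2c}-\frac{b}{2c}$, $\sigma_4=\frac v2-\frac{a}{2c}+\frac{b}{2c}$, $\sigma_5=\frac v2+\frac{a}{2c}+\frac{b}{2c}$, $\sigma_6=\frac v2+\frac{a}{2c}-\frac{b}{2c}$, and $P=(vc-a-b)(vc+a+b)(vc-a+b)(vc+a-b)=\{(vc)^2-(a+b)^2\}\{(vc)^2-(a-b)^2\}$. Assume $\frac v2\notin\mathbb{Z}_0^-$ and $1+\sigma_j\notin\mathbb{Z}_0^-$ for $j=3,4,5,6$. Then $$ {}_6F_5\!\left(\begin{matrix}v,\ 1+\frac v2,\ \sigma_3,\ \sigma_5,\ \sigma_4,\ \sigma_6\\ \frac v2,\ 1+\sigma_3,\ 1+\sigma_5,\ 1+\sigma_4,\ 1+\sigma_6\end{matrix};\,-1\right) =\frac{P}{16\,v\,a\,b\,c^{2}\,\Gamma(v)}\Big[\Gamma(\sigma_5)\Gamma(\sigma_3)-\Gamma(\sigma_6)\Gamma(\sigma_4)\Big]. $$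
   Context: $\mathbb{Z}_0^-=\{0,-1,-2,\dots\}$. The Pochhammer symbol is $(\lambda)_0=1$, $(\lambda)_n=\lambda(\lambda+1)\cdots(\lambda+n-1)$ for $n\ge1$. The generalized hypergeometric series is ${}_pF_q\!\left(\begin{matrix}\alpha_1,\dots,\alpha_p\\ \beta_1,\dots,\beta_q\end{matrix};z\right)=\sum_{n=0}^\infty\frac{(\alpha_1)_n\cdots(\alpha_p)_n}{(\beta_1)_n\cdots(\beta_q)_n}\frac{z^n}{n!}$ (with no $\beta_j\in\mathbb{Z}_0^-$); when $p=q+1$ and $|z|=1$, $z\ne 1$, it converges if $\Re(\sum\beta_j-\sum\alpha_i)>-1$, and for $z=1$ it converges if $\Re(\sum\beta_j-\sum\alpha_i)>0$. $\Gamma$ is Euler's gamma function. *)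

(* Defs.v *)
From Stdlib Require Import Reals List Arith ClassicalEpsilon.
From Stdlib Require Import Factorial.
Open Scope R_scope.

Definition Cx : Type := (R * R)%type.
Definition Re (z : Cx) : R := fst z.
Definition Im (z : Cx) : R := snd z.
Definition RtoC (x : R) : Cx := (x, 0).
Definition Cadd (z w : Cx) : Cx := (Re z + Re w, Im z + Im w).
Definition Copp (z : Cx) : Cx := (- Re z, - Im z).
Definition Csub (z w : Cx) : Cx := Cadd z (Copp w).
Definition Cmul (z w : Cx) : Cx :=
  (Re z * Re w - Im z * Im w, Re z * Im w + Im z * Re w).
Definition Cinv (z : Cx) : Cx :=
  (Re z / (Re z ^ 2 + Im z ^ 2), - Im z / (Re z ^ 2 + Im z ^ 2)).
Definition Cdiv (z w : Cx) : Cx := Cmul z (Cinv w).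
Definition Cnorm (z : Cx) : R := sqrt (Re z ^ 2 + Im z ^ 2).
Fixpoint Cpow (z : Cx) (n : nat) : Cx :=
  match n with O => RtoC 1 | S m => Cmul z (Cpow z m) end.
Definition Cexp (z : Cx) : Cx := (exp (Re z) * cos (Im z), exp (Re z) * sin (Im z)).
Definition Rpow_C (x : R) (z : Cx) : Cx := Cexp (Cmul z (RtoC (ln x))).

Declare Scope C_scope.
Delimit Scope C_scope with C.
Notation "z + w" := (Cadd z w) : C_scope.
Notation "z - w" := (Csub z w) : C_scope.
Notation "- z" := (Copp z) : C_scope.
Notation "z * w" := (Cmul z w) : C_scope.
Notation "z / w" := (Cdiv z w) : C_scope.
Notation "z ^ n" := (Cpow z n) : C_scope.

Fixpoint poch (z : Cx) (n : nat) : Cx :=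
  match n with
  | O => RtoC 1
  | S m => Cmul (poch z m) (Cadd z (RtoC (INR m)))
  end.

Definition Cprod (l : list Cx) : Cx := fold_right Cmul (RtoC 1) l.

Fixpoint Csum (f : nat -> Cx) (N : nat) : Cx :=
  match N with O => f O | S M => Cadd (Csum f M) (f (S M)) end.

Definition in_Z0m (z : Cx) : Prop := exists k : nat, z = RtoC (- INR k).

Definition Ccv (u : nat -> Cx) (l : Cx) : Prop :=
  forall eps : R, eps > 0 ->
    exists N : nat, forall n : nat, (n >= N)%nat -> Cnorm (Csub (u n) l) < eps.

(* ---------- Gamma function (Gauss/Euler limit formula) ----------
   Gamma z = lim_{n->oo} n! n^z / (z (z+1) ... (z+n)),  z notin Z_0^-.
   Defined as that limit when it exists (0 otherwise, never used). *)
Definition Gamma_seq (z : Cx) (n : nat) : Cx :=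
  Cdiv (Cmul (RtoC (INR (fact n))) (Rpow_C (INR n) z)) (poch z (S n)).

Definition Gamma (z : Cx) : Cx :=
  match excluded_middle_informative (exists g, Ccv (Gamma_seq z) g) with
  | left H => proj1_sig (constructive_indefinite_description _ H)
  | right _ => RtoC 0
  end.

Definition hyp_term (alphas betas : list Cx) (z : Cx) (n : nat) : Cx :=
  Cdiv (Cmul (Cprod (map (fun a => poch a n) alphas)) (Cpow z n))
       (Cmul (Cprod (map (fun b => poch b n) betas)) (RtoC (INR (fact n)))).

Definition hyp_sum (alphas betas : list Cx) (z : Cx) (L : Cx) : Prop :=
  Ccv (Csum (hyp_term alphas betas z)) L.

(* Main.v *)
Require Import Defs.
From Stdlib Require Import Reals List Factorial ClassicalEpsilon Lra Lia.
Import ListNotations.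
Open Scope R_scope.

(** Put [x_n = n (n + v)].  If [X = s s'] with [s + s' = v] then [(n + s) (n + s') = x_n + X], so
    the summand of the 6F5 is a multiple of [w_n / ((x_n + X) (x_n + Y))] with [X = s3 s5],
    [Y = s4 s6] and [w_n = (-1)^n (v)_n / n! (v + 2 n)], hence of
    [w_n / (x_n + X) - w_n / (x_n + Y)].  The partial fraction expansion of
    [1 / prod_(n <= N) (x_n + X)] reads
    [sum_(n <= N) w_n kappa_(N,n) / (x_n + X) = N! (v)_(N+1) / ((s)_(N+1) (s')_(N+1))],
    where [kappa_(N,n) = (-1)^n (-N)_n / (1+v+N)_n], and its right-hand side is a quotient of Gauss
    products converging to [Gamma s * Gamma s' / Gamma v].  On the left, [kappa_(N,n)] tends to 1
    with bounded variation in [n], so Toeplitz' theorem removes it, even though the 6F5 series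
    converges only conditionally when [3 <= Re v < 4]. *)

(** For 2 <= Re v < 4 the two series with summands w_n / (x_n + X) and w_n / (x_n + Y) diverge
    separately, since their terms are of order n^(Re v - 2); only the difference, of order n^(Re v -
    4), can be summed. Hence the kappas are removed from the difference, while the closed form is
    applied to each half at finite N. Removing them presupposes a convergent series, so convergence
    is proved beforehand, without knowledge of the sum. All existence of limits rests on ratios of
    consecutive terms of the form 1 + alpha/n + O(1/n^2). If alpha = 0, the sequence converges;
    applied to the Gauss products and to their reciprocals, this gives Gamma and its nonvanishing.
    If Re alpha < 0, the sequence tends to 0 with bounded variation, and its alternating series
    converges. The splitting divides by Y - X = a b / c^2, which is where a and b must be nonzero
    and where the denominator a b of the formula comes from. *)

(** * Field structure and modulus of the complex numbers *)

Lemma Cx_eq (z w : Cx) : Re z = Re w -> Im z = Im w -> z = w.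
Proof. destruct z, w; simpl; intros -> ->; reflexivity. Qed.

Lemma Re_Im_sq_neq0 (z : Cx) : z <> RtoC 0 -> Re z ^ 2 + Im z ^ 2 <> 0.
Proof.
  intros Hz H; apply Hz, Cx_eq; simpl.
  - nra.
  - nra.
Qed.

Lemma Cx_field_theory :
  field_theory (RtoC 0) (RtoC 1) Cadd Cmul Csub Copp Cdiv Cinv (@eq Cx).
Proof.
  constructor; [constructor | | |]; intros; try reflexivity;
    try (apply Cx_eq; simpl; ring).
  - intros H; injection H; lra.
  - pose proof (Re_Im_sq_neq0 p H) as Hp.
    apply Cx_eq; simpl; field; intros E; apply Hp; rewrite <- E; ring.
Qed.

Add Field Cx_field : Cx_field_theory.

Lemma RtoC_add (x y : R) : RtoC (x + y) = (RtoC x + RtoC y)%C.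
Proof. apply Cx_eq; simpl; ring. Qed.

Lemma RtoC_opp (x : R) : RtoC (- x) = (- RtoC x)%C.
Proof. apply Cx_eq; simpl; ring. Qed.

Lemma RtoC_sub (x y : R) : RtoC (x - y) = (RtoC x - RtoC y)%C.
Proof. apply Cx_eq; simpl; ring. Qed.

Lemma RtoC_mul (x y : R) : RtoC (x * y) = (RtoC x * RtoC y)%C.
Proof. apply Cx_eq; simpl; ring. Qed.

Lemma RtoC_inj (x y : R) : RtoC x = RtoC y -> x = y.
Proof. intros H; injection H; auto. Qed.

Lemma RtoC_neq0 (x : R) : x <> 0 -> RtoC x <> RtoC 0.
Proof. intros Hx H; apply Hx, RtoC_inj, H. Qed.

Lemma RtoC_INR_S (n : nat) : RtoC (INR (S n)) = (RtoC (INR n) + RtoC 1)%C.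
Proof. rewrite S_INR; apply RtoC_add. Qed.

Lemma RtoC_inv (x : R) : x <> 0 -> RtoC (/ x) = Cinv (RtoC x).
Proof. intros; apply Cx_eq; simpl; field; nra. Qed.

Lemma Cmul_neq0 (z w : Cx) : z <> RtoC 0 -> w <> RtoC 0 -> (z * w)%C <> RtoC 0.
Proof.
  intros Hz Hw H; apply Hw.
  replace w with (z * w / z)%C by (field; exact Hz).
  rewrite H; field; exact Hz.
Qed.

Lemma Cmul_neq0_l (z w : Cx) : (z * w)%C <> RtoC 0 -> z <> RtoC 0.
Proof. intros H E; apply H; rewrite E; ring. Qed.

Lemma Cmul_neq0_r (z w : Cx) : (z * w)%C <> RtoC 0 -> w <> RtoC 0.
Proof. intros H E; apply H; rewrite E; ring. Qed.

Lemma Cnorm_ge0 (z : Cx) : 0 <= Cnorm z.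
Proof. apply sqrt_pos. Qed.

Lemma Cnorm_sq (z : Cx) : Cnorm z * Cnorm z = Re z ^ 2 + Im z ^ 2.
Proof. apply sqrt_sqrt; nra. Qed.

Lemma Cnorm_mul (z w : Cx) : Cnorm (z * w)%C = Cnorm z * Cnorm w.
Proof.
  unfold Cnorm; rewrite <- sqrt_mult by nra; f_equal; simpl; ring.
Qed.

Lemma Cnorm_RtoC (x : R) : Cnorm (RtoC x) = Rabs x.
Proof.
  unfold Cnorm; simpl.
  replace (x * (x * 1) + 0 * (0 * 1)) with (Rsqr x) by (unfold Rsqr; ring).
  apply sqrt_Rsqr_abs.
Qed.

Lemma Cnorm_opp (z : Cx) : Cnorm (- z)%C = Cnorm z.
Proof. unfold Cnorm; f_equal; simpl; ring. Qed.

Lemma Cnorm_triangle (z w : Cx) : Cnorm (z + w)%C <= Cnorm z + Cnorm w.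
Proof.
  pose proof (Cnorm_sq z); pose proof (Cnorm_sq w); pose proof (Cnorm_sq (z + w)%C).
  pose proof (Cnorm_ge0 z); pose proof (Cnorm_ge0 w); pose proof (Cnorm_ge0 (z + w)%C).
  assert (Hcs : Re z * Re w + Im z * Im w <= Cnorm z * Cnorm w).
  { assert ((Cnorm z * Cnorm w) * (Cnorm z * Cnorm w)
            = (Re z ^ 2 + Im z ^ 2) * (Re w ^ 2 + Im w ^ 2)) by (rewrite <- H, <- H0; ring).
    assert (0 <= Cnorm z * Cnorm w) by nra.
    pose proof (Rle_0_sqr (Re z * Im w - Im z * Re w)); unfold Rsqr in *.
    nra. }
  simpl in H1; nra.
Qed.

Lemma Cnorm_sub_sym (z w : Cx) : Cnorm (z - w)%C = Cnorm (w - z)%C.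
Proof. rewrite <- Cnorm_opp; f_equal; ring. Qed.

Lemma Cnorm_triangle_rev (z w : Cx) : Cnorm z - Cnorm w <= Cnorm (z - w)%C.
Proof.
  pose proof (Cnorm_triangle (z - w)%C w).
  replace (z - w + w)%C with z in H by ring; lra.
Qed.

Lemma Rabs_Re_le (z : Cx) : Rabs (Re z) <= Cnorm z.
Proof.
  pose proof (Cnorm_sq z); pose proof (Cnorm_ge0 z).
  apply Rabs_le; nra.
Qed.

Lemma Rabs_Im_le (z : Cx) : Rabs (Im z) <= Cnorm z.
Proof.
  pose proof (Cnorm_sq z); pose proof (Cnorm_ge0 z).
  apply Rabs_le; nra.
Qed.

Lemma Re_le_Cnorm (z : Cx) : Re z <= Cnorm z.
Proof. pose proof (Rabs_Re_le z); pose proof (Rle_abs (Re z)); lra. Qed.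

Lemma Cnorm_le_parts (z : Cx) : Cnorm z <= Rabs (Re z) + Rabs (Im z).
Proof.
  pose proof (Cnorm_sq z); pose proof (Cnorm_ge0 z).
  pose proof (Rabs_pos (Re z)); pose proof (Rabs_pos (Im z)).
  pose proof (pow2_abs (Re z)); pose proof (pow2_abs (Im z)).
  nra.
Qed.

Lemma Cnorm_eq0 (z : Cx) : Cnorm z = 0 -> z = RtoC 0.
Proof.
  intros H; pose proof (Cnorm_sq z); rewrite H in H0.
  apply Cx_eq; simpl; nra.
Qed.

Lemma Cnorm_pos (z : Cx) : z <> RtoC 0 -> 0 < Cnorm z.
Proof.
  intros Hz; destruct (Cnorm_ge0 z) as [|E]; [assumption|].
  exfalso; apply Hz, Cnorm_eq0; auto.
Qed.

Lemma Cnorm_div (z w : Cx) : w <> RtoC 0 -> Cnorm (z / w)%C = Cnorm z / Cnorm w.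
Proof.
  intros Hw; pose proof (Cnorm_pos w Hw).
  assert (E : Cnorm z = Cnorm (z / w)%C * Cnorm w)
    by (rewrite <- Cnorm_mul; f_equal; field; exact Hw).
  rewrite E; field; lra.
Qed.

(** * Limits of complex sequences *)

Lemma Ccv_parts (u : nat -> Cx) (l : Cx) :
  Ccv u l <-> Un_cv (fun n => Re (u n)) (Re l) /\ Un_cv (fun n => Im (u n)) (Im l).
Proof.
  split.
  - intros H; split; intros eps He; destruct (H eps He) as [N HN]; exists N; intros n Hn;
      specialize (HN n Hn); unfold Rdist.
    + pose proof (Rabs_Re_le (u n - l)%C) as Hr; simpl in Hr; unfold Rminus; lra.
    + pose proof (Rabs_Im_le (u n - l)%C) as Hr; simpl in Hr; unfold Rminus; lra.
  - intros [H1 H2] eps He.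
    destruct (H1 (eps / 2)) as [N1 HN1]; [lra|].
    destruct (H2 (eps / 2)) as [N2 HN2]; [lra|].
    exists (Nat.max N1 N2); intros n Hn.
    specialize (HN1 n ltac:(lia)); specialize (HN2 n ltac:(lia)); unfold Rdist in *.
    pose proof (Cnorm_le_parts (u n - l)%C) as Hr; simpl in Hr; unfold Rminus in *; lra.
Qed.

Lemma Ccv_unique (u : nat -> Cx) (l m : Cx) : Ccv u l -> Ccv u m -> l = m.
Proof.
  rewrite !Ccv_parts; intros [H1 H2] [H3 H4].
  apply Cx_eq; eapply UL_sequence; eauto.
Qed.

Lemma Ccv_const (l : Cx) : Ccv (fun _ => l) l.
Proof.
  intros eps He; exists O; intros n _.
  replace (l - l)%C with (RtoC 0) by ring.
  rewrite Cnorm_RtoC, Rabs_R0; lra.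
Qed.

Lemma Ccv_add (u w : nat -> Cx) (l m : Cx) :
  Ccv u l -> Ccv w m -> Ccv (fun n => u n + w n)%C (l + m)%C.
Proof.
  rewrite !Ccv_parts; intros [H1 H2] [H3 H4]; split; simpl; apply CV_plus; assumption.
Qed.

Lemma Ccv_mul (u w : nat -> Cx) (l m : Cx) :
  Ccv u l -> Ccv w m -> Ccv (fun n => u n * w n)%C (l * m)%C.
Proof.
  rewrite !Ccv_parts; intros [H1 H2] [H3 H4]; split; simpl.
  - apply CV_minus; apply CV_mult; assumption.
  - apply CV_plus; apply CV_mult; assumption.
Qed.

Lemma Ccv_ext (u w : nat -> Cx) (l : Cx) (N : nat) :
  (forall n, (n >= N)%nat -> u n = w n) -> Ccv u l -> Ccv w l.
Proof.
  intros E H eps He; destruct (H eps He) as [M HM]; exists (Nat.max N M); intros n Hn.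
  rewrite <- E by lia; apply HM; lia.
Qed.

Lemma Ccv_sub (u w : nat -> Cx) (l m : Cx) :
  Ccv u l -> Ccv w m -> Ccv (fun n => u n - w n)%C (l - m)%C.
Proof.
  intros H1 H2.
  replace (l - m)%C with (l + - RtoC 1 * m)%C by ring.
  eapply Ccv_ext with (N := O);
    [|apply (Ccv_add _ _ _ _ H1 (Ccv_mul _ _ _ _ (Ccv_const _) H2))].
  intros n _; cbv beta; ring.
Qed.

(** The majorant [b] decreases and is bounded below, so it is Cauchy, and [u] inherits this. Every
    limit whose value is not known in advance is obtained from this criterion. *)
Lemma Ccv_of_telescoping_bound (u : nat -> Cx) (b : nat -> R) (N : nat) :
  (forall n, (n >= N)%nat -> 0 <= b n) ->
  (forall n, (n >= N)%nat -> Cnorm (u (S n) - u n)%C <= b n - b (S n)) ->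
  exists l, Ccv u l.
Proof.
  intros Hb Hu.
  assert (Hd : forall n k, (n >= N)%nat -> Cnorm (u (n + k)%nat - u n)%C <= b n - b (n + k)%nat).
  { intros n k Hn; induction k as [|k IH].
    - rewrite Nat.add_0_r; replace (u n - u n)%C with (RtoC 0) by ring.
      rewrite Cnorm_RtoC, Rabs_R0; lra.
    - rewrite Nat.add_succ_r.
      replace (u (S (n + k)) - u n)%C
        with ((u (S (n + k)) - u (n + k)%nat) + (u (n + k)%nat - u n))%C by ring.
      eapply Rle_trans; [apply Cnorm_triangle|].
      specialize (Hu (n + k)%nat ltac:(lia)); lra. }
  assert (Hdec : Un_decreasing (fun k => b (N + k)%nat)).
  { intros k; specialize (Hu (N + k)%nat ltac:(lia)).
    pose proof (Cnorm_ge0 (u (S (N + k)) - u (N + k)%nat)%C).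
    rewrite Nat.add_succ_r; lra. }
  assert (Hlb : has_lb (fun k => b (N + k)%nat)).
  { exists 0; intros x [i ->]; unfold opp_seq; specialize (Hb (N + i)%nat ltac:(lia)); lra. }
  destruct (decreasing_cv _ Hdec Hlb) as [lb Hcv].
  pose proof (CV_Cauchy _ (exist _ lb Hcv)) as HC.
  assert (HCu : forall eps, eps > 0 -> exists M, forall n m, (n >= M)%nat -> (m >= M)%nat ->
            Cnorm (u n - u m)%C < eps).
  { intros eps He; destruct (HC eps He) as [M HM]; exists (N + M)%nat; intros n m Hn Hm.
    assert (Hlt : forall n m, (n >= N + M)%nat -> (m >= n)%nat -> Cnorm (u m - u n)%C < eps).
    { clear n m Hn Hm; intros n m Hn Hm.
      specialize (Hd n (m - n)%nat ltac:(lia)).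
      replace (n + (m - n))%nat with m in Hd by lia.
      specialize (HM (n - N)%nat (m - N)%nat ltac:(lia) ltac:(lia)).
      replace (N + (n - N))%nat with n in HM by lia.
      replace (N + (m - N))%nat with m in HM by lia.
      unfold Rdist in HM; pose proof (Rle_abs (b n - b m)); lra. }
    destruct (Nat.le_ge_cases n m).
    - rewrite Cnorm_sub_sym; apply Hlt; lia.
    - apply Hlt; lia. }
  destruct (R_complete (fun n => Re (u n))) as [x Hx].
  { intros eps He; destruct (HCu eps He) as [M HM]; exists M; intros n m Hn Hm.
    specialize (HM n m Hn Hm); unfold Rdist.
    pose proof (Rabs_Re_le (u n - u m)%C) as Hr; simpl in Hr; unfold Rminus; lra. }
  destruct (R_complete (fun n => Im (u n))) as [y Hy].
  { intros eps He; destruct (HCu eps He) as [M HM]; exists M; intros n m Hn Hm.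
    specialize (HM n m Hn Hm); unfold Rdist.
    pose proof (Rabs_Im_le (u n - u m)%C) as Hr; simpl in Hr; unfold Rminus; lra. }
  exists (x, y); apply Ccv_parts; split; assumption.
Qed.

(** * Elementary inequalities; complex exponential and powers *)

Lemma eventually_inv_INR_le (eta : R) : eta > 0 ->
  exists N, (1 <= N)%nat /\ forall n, (n >= N)%nat -> 0 < / INR n <= eta.
Proof.
  intros He; destruct (INR_unbounded (/ eta)) as [N HN].
  pose proof (Rinv_0_lt_compat _ He).
  assert (1 <= N)%nat by (destruct N; [simpl in HN; lra|lia]).
  exists N; split; [assumption|]; intros n Hn.
  assert (INR N <= INR n) by (apply le_INR; lia).
  split; [apply Rinv_0_lt_compat; lra|].
  rewrite <- (Rinv_inv eta); apply Rinv_le_contravar; lra.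
Qed.

Lemma inv_INR_bounds (n : nat) : (1 <= n)%nat -> 0 < / INR n <= 1.
Proof.
  intros Hn; assert (1 <= INR n) by (apply (le_INR 1); lia).
  split; [apply Rinv_0_lt_compat; lra|].
  rewrite <- Rinv_1; apply Rinv_le_contravar; lra.
Qed.

(** From n + 1 <= 2 n. It turns errors O(1/n^2) into the telescoping majorants that the convergence
    criterion asks for. *)
Lemma inv_INR_sq_le_telescope (n : nat) : (1 <= n)%nat ->
  (/ INR n) ^ 2 <= 2 * (/ INR n - / INR (S n)).
Proof.
  intros Hn; assert (1 <= INR n) by (apply (le_INR 1); lia); rewrite S_INR.
  assert (E : 2 * (/ INR n - / (INR n + 1)) - (/ INR n) ^ 2
              = (INR n - 1) * / (INR n ^ 2 * (INR n + 1))) by (field; lra).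
  assert (0 <= / (INR n ^ 2 * (INR n + 1)))
    by (apply Rlt_le, Rinv_0_lt_compat; nra).
  nra.
Qed.

Lemma exp_le_compat (x y : R) : x <= y -> exp x <= exp y.
Proof. intros [H| ->]; [left; apply exp_increasing, H|right; reflexivity]. Qed.

Lemma Cexp_add (z w : Cx) : Cexp (z + w)%C = (Cexp z * Cexp w)%C.
Proof.
  apply Cx_eq; simpl; rewrite exp_plus; [rewrite cos_plus|rewrite sin_plus]; ring.
Qed.

Lemma Cexp_0 : Cexp (RtoC 0) = RtoC 1.
Proof. apply Cx_eq; simpl; rewrite exp_0, ?cos_0, ?sin_0; ring. Qed.

Lemma Cexp_neq0 (z : Cx) : Cexp z <> RtoC 0.
Proof.
  apply Cmul_neq0_l with (w := Cexp (- z)%C).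
  rewrite <- Cexp_add; replace (z + - z)%C with (RtoC 0) by ring.
  rewrite Cexp_0; apply RtoC_neq0; lra.
Qed.

Lemma Rpow_C_add (x : R) (z w : Cx) : Rpow_C x (z + w)%C = (Rpow_C x z * Rpow_C x w)%C.
Proof. unfold Rpow_C; rewrite <- Cexp_add; f_equal; ring. Qed.

Lemma Rpow_C_neq0 (x : R) (z : Cx) : Rpow_C x z <> RtoC 0.
Proof. apply Cexp_neq0. Qed.

Lemma Rpow_C_0 (x : R) : Rpow_C x (RtoC 0) = RtoC 1.
Proof. unfold Rpow_C; rewrite <- Cexp_0; f_equal; ring. Qed.

Lemma Rpow_C_opp (x : R) (z : Cx) : Rpow_C x (- z)%C = (RtoC 1 / Rpow_C x z)%C.
Proof.
  replace (RtoC 1) with (Rpow_C x (- z)%C * Rpow_C x z)%C.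
  - field; apply Rpow_C_neq0.
  - rewrite <- Rpow_C_add; replace (- z + z)%C with (RtoC 0) by ring; apply Rpow_C_0.
Qed.

Lemma Rpow_C_mult (x y : R) (z : Cx) : 0 < x -> 0 < y ->
  Rpow_C (x * y) z = (Rpow_C x z * Rpow_C y z)%C.
Proof.
  intros Hx Hy; unfold Rpow_C; rewrite <- Cexp_add, ln_mult, RtoC_add by assumption.
  f_equal; ring.
Qed.

(** Only exp t >= 1 + t is used: at t = -x it gives exp x <= 1 / (1 - x), and 1 / (1 - x) - 1 - x =
    x^2 / (1 - x) <= 2 x^2. *)
Lemma exp_sub_linear_bound (x : R) : Rabs x <= 1 / 2 -> Rabs (exp x - 1 - x) <= 2 * x ^ 2.
Proof.
  intros Hx; assert (Hb : - (1 / 2) <= x <= 1 / 2)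
    by (revert Hx; unfold Rabs; destruct (Rcase_abs x); lra).
  pose proof (exp_ineq1_le x); pose proof (exp_ineq1_le (- x)).
  pose proof (exp_pos x); pose proof (exp_pos (- x)).
  assert (exp x * exp (- x) = 1) by (rewrite <- exp_plus, Rplus_opp_r; apply exp_0).
  apply Rabs_le; split; [nra|].
  assert (exp x * (1 - x) <= 1) by nra.
  nra.
Qed.

Lemma Rabs_sin_le (x : R) : Rabs (sin x) <= Rabs x.
Proof.
  assert (H : forall y, 0 < y -> Rabs (sin y) <= y).
  { intros y Hy; apply Rabs_le; split; [|left; apply sin_lt_x; assumption].
    destruct (MVT_cor2 (fun t => sin t + t) (fun t => cos t + 1) 0 y Hy) as [c [Hc _]].
    - intros c _; apply derivable_pt_lim_plus;
        [apply derivable_pt_lim_sin|apply derivable_pt_lim_id].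
    - rewrite sin_0 in Hc; pose proof (COS_bound c); nra. }
  destruct (Rtotal_order x 0) as [Hx|[->|Hx]].
  - rewrite <- (Rabs_Ropp (sin x)), <- sin_neg, (Rabs_left x Hx); apply H; lra.
  - rewrite sin_0; lra.
  - rewrite (Rabs_right x) by lra; apply H, Hx.
Qed.

Lemma cos_sub_1_bound (x : R) : Rabs (cos x - 1) <= x ^ 2.
Proof.
  replace x with (2 * (x / 2)) by lra; rewrite cos_2a_sin.
  pose proof (Rabs_sin_le (x / 2)) as H; apply Rsqr_le_abs_1 in H; unfold Rsqr in H.
  apply Rabs_le; nra.
Qed.

Lemma sin_sub_id_bound (x : R) : Rabs x <= 1 -> Rabs (sin x - x) <= x ^ 2.
Proof.
  assert (H : forall y, 0 < y <= 1 -> Rabs (sin y - y) <= y ^ 2).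
  { intros y [Hy Hy1].
    destruct (MVT_cor2 (fun t => sin t - t) (fun t => cos t - 1) 0 y Hy) as [c [Hc Hcy]].
    - intros c _; apply derivable_pt_lim_minus;
        [apply derivable_pt_lim_sin|apply derivable_pt_lim_id].
    - rewrite sin_0 in Hc; replace (sin y - y) with ((cos c - 1) * (y - 0)) by lra.
      rewrite Rabs_mult, (Rabs_right (y - 0)) by lra.
      pose proof (cos_sub_1_bound c); pose proof (Rabs_pos (cos c - 1)); nra. }
  intros Hx; destruct (Rtotal_order x 0) as [Hx0|[->|Hx0]].
  - rewrite (Rabs_left x Hx0) in Hx.
    rewrite <- (Rabs_Ropp (sin x - x)).
    replace (- (sin x - x)) with (sin (- x) - - x) by (rewrite sin_neg; ring).
    replace (x ^ 2) with ((- x) ^ 2) by ring; apply H; lra.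
  - rewrite sin_0, Rminus_0_r, Rabs_R0; lra.
  - rewrite (Rabs_right x) in Hx by lra; apply H; lra.
Qed.

(** The constant 10 is generous; only the quadratic order matters later. *)
Lemma Cexp_sub_linear_bound (w : Cx) : Cnorm w <= 1 / 2 ->
  Cnorm (Cexp w - (RtoC 1 + w))%C <= 10 * Cnorm w ^ 2.
Proof.
  intros Hw; pose proof (Rabs_Re_le w) as Hx; pose proof (Rabs_Im_le w) as Hy.
  pose proof (Cnorm_sq w) as Hsq.
  destruct w as [x y]; simpl in Hx, Hy, Hsq.
  set (r := Cnorm (x, y)) in *.
  pose proof (exp_sub_linear_bound x ltac:(lra)) as He.
  pose proof (cos_sub_1_bound y) as Hc.
  pose proof (sin_sub_id_bound y ltac:(lra)) as Hs.
  pose proof (Rabs_sin_le y) as Hs1.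
  pose proof (Rabs_pos x); pose proof (Rabs_pos y).
  pose proof (pow2_abs x) as Ex; pose proof (pow2_abs y) as Ey.
  assert (Hr : r ^ 2 = Rabs x ^ 2 + Rabs y ^ 2) by (rewrite Ex, Ey; lra).
  assert (He1 : Rabs (exp x - 1) <= 2 * Rabs x).
  { replace (exp x - 1) with ((exp x - 1 - x) + x) by ring.
    eapply Rle_trans; [apply Rabs_triang|]; nra. }
  assert (Hcos : Rabs (cos y) <= 1) by (pose proof (COS_bound y); apply Rabs_le; lra).
  eapply Rle_trans; [apply Cnorm_le_parts|]; simpl.
  assert (H1 : Rabs (exp x * cos y + - (1 + x)) <= 2 * x ^ 2 + 2 * y ^ 2).
  { replace (exp x * cos y + - (1 + x))
      with ((exp x - 1 - x) * cos y + (1 + x) * (cos y - 1)) by ring.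
    eapply Rle_trans; [apply Rabs_triang|]; rewrite !Rabs_mult.
    assert (Rabs (1 + x) <= 2)
      by (eapply Rle_trans; [apply Rabs_triang|]; rewrite Rabs_R1; lra).
    pose proof (Rabs_pos (exp x - 1 - x)); pose proof (Rabs_pos (cos y - 1));
      pose proof (Rabs_pos (cos y)); pose proof (Rabs_pos (1 + x)).
    apply Rplus_le_compat; nra. }
  assert (H2 : Rabs (exp x * sin y + - (0 + y)) <= 2 * Rabs x * Rabs y + y ^ 2).
  { replace (exp x * sin y + - (0 + y)) with ((exp x - 1) * sin y + (sin y - y)) by ring.
    eapply Rle_trans; [apply Rabs_triang|]; rewrite Rabs_mult.
    pose proof (Rabs_pos (exp x - 1)); pose proof (Rabs_pos (sin y)); nra. }
  change (r * (r * 1)) with (r ^ 2); rewrite Hr, Ex, Ey; nra.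
Qed.

(** The lower bound is exp t >= 1 + t at t = -ln (1 + h), which yields ln (1 + h) >= h / (1 + h) >=
    h - h^2. *)
Lemma ln_1p_bounds (h : R) : 0 < h -> h - h ^ 2 <= ln (1 + h) <= h.
Proof.
  intros Hh; split.
  - assert (Hi : 0 < / (1 + h)) by (apply Rinv_0_lt_compat; lra).
    assert (E : (1 + h) * / (1 + h) = 1) by (field; lra).
    pose proof (exp_ineq1_le (ln (/ (1 + h)))) as H.
    rewrite exp_ln in H by assumption; rewrite ln_Rinv in H by lra; nra.
  - pose proof (exp_ineq1_le (ln (1 + h))) as H; rewrite exp_ln in H; lra.
Qed.

(** * Sequences with ratios 1 + alpha/n + O(1/n^2) *)

(** A sequence with such ratios behaves like n^alpha, so [alpha] plays the role of a growth exponent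
    and is additive under products. *)
Definition asymp1 (u : nat -> Cx) (alpha : Cx) : Prop :=
  exists (C : R) (N : nat), 0 <= C /\ (1 <= N)%nat /\
    forall n, (n >= N)%nat ->
      Cnorm (u n - (RtoC 1 + alpha * RtoC (/ INR n)))%C <= C * (/ INR n) ^ 2.

Lemma asymp1_mul (u w : nat -> Cx) (alpha beta : Cx) :
  asymp1 u alpha -> asymp1 w beta -> asymp1 (fun n => u n * w n)%C (alpha + beta)%C.
Proof.
  intros [C [N [HC [HN Hu]]]] [D [M [HD [HM Hw]]]].
  pose proof (Cnorm_ge0 alpha) as Ha; pose proof (Cnorm_ge0 beta) as Hb.
  exists (Cnorm alpha * Cnorm beta + C * (1 + Cnorm beta + D) + D * (1 + Cnorm alpha)),
    (Nat.max N M).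
  split; [nra|split; [lia|]].
  intros n Hn; specialize (Hu n ltac:(lia)); specialize (Hw n ltac:(lia)).
  destruct (inv_INR_bounds n ltac:(lia)) as [Hh0 Hh1].
  set (h := / INR n) in *.
  set (e := (u n - (RtoC 1 + alpha * RtoC h))%C) in *.
  set (f := (w n - (RtoC 1 + beta * RtoC h))%C) in *.
  replace (u n * w n - (RtoC 1 + (alpha + beta) * RtoC h))%C
    with (alpha * beta * (RtoC h * RtoC h) + e * (RtoC 1 + beta * RtoC h + f)
          + f * (RtoC 1 + alpha * RtoC h))%C by (unfold e, f; ring).
  assert (Hnb : Cnorm (RtoC 1 + beta * RtoC h + f)%C <= 1 + Cnorm beta + D).
  { eapply Rle_trans; [apply Cnorm_triangle|].
    pose proof (Cnorm_triangle (RtoC 1) (beta * RtoC h)%C) as H.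
    rewrite Cnorm_mul, !Cnorm_RtoC, Rabs_R1, (Rabs_right h) in H by lra.
    assert (Cnorm beta * h <= Cnorm beta) by nra.
    assert (D * h ^ 2 <= D * 1) by (apply Rmult_le_compat_l; nra); lra. }
  assert (Hna : Cnorm (RtoC 1 + alpha * RtoC h)%C <= 1 + Cnorm alpha).
  { pose proof (Cnorm_triangle (RtoC 1) (alpha * RtoC h)%C) as H.
    rewrite Cnorm_mul, !Cnorm_RtoC, Rabs_R1, (Rabs_right h) in H by lra; nra. }
  eapply Rle_trans; [apply Cnorm_triangle|].
  eapply Rle_trans; [apply Rplus_le_compat_r, Cnorm_triangle|].
  rewrite !Cnorm_mul, Cnorm_RtoC, (Rabs_right h) by lra.
  assert (Cnorm e * Cnorm (RtoC 1 + beta * RtoC h + f)%C <= (C * h ^ 2) * (1 + Cnorm beta + D))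
    by (apply Rmult_le_compat; auto using Cnorm_ge0).
  assert (Cnorm f * Cnorm (RtoC 1 + alpha * RtoC h)%C <= (D * h ^ 2) * (1 + Cnorm alpha))
    by (apply Rmult_le_compat; auto using Cnorm_ge0).
  nra.
Qed.

Lemma Cnorm_INR_add_ge (n : nat) (q : Cx) : INR n - Cnorm q <= Cnorm (RtoC (INR n) + q)%C.
Proof.
  pose proof (Cnorm_triangle_rev (RtoC (INR n)) (- q)%C) as H.
  rewrite Cnorm_opp, Cnorm_RtoC, Rabs_right in H by (apply Rle_ge, pos_INR).
  replace (RtoC (INR n) - - q)%C with (RtoC (INR n) + q)%C in H by ring; exact H.
Qed.

(** The remainder is exactly -(p - q) q / (n (n + q)), and [N] is taken so large that |n + q| >=
    n/2. *)
Lemma asymp1_frac (p q : Cx) :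
  asymp1 (fun n => (RtoC (INR n) + p) / (RtoC (INR n) + q))%C (p - q)%C.
Proof.
  pose proof (Cnorm_ge0 q) as Hq; pose proof (Cnorm_ge0 (p - q)%C) as Hpq.
  destruct (INR_unbounded (2 * Cnorm q + 1)) as [N HN].
  exists (2 * Cnorm (p - q)%C * Cnorm q), (S N); split; [nra|split; [lia|]].
  intros n Hn.
  assert (INR N <= INR n) by (apply le_INR; lia).
  pose proof (Cnorm_INR_add_ge n q) as Hge.
  assert (Hn0 : RtoC (INR n) <> RtoC 0) by (apply RtoC_neq0; lra).
  assert (Hnq : (RtoC (INR n) + q)%C <> RtoC 0).
  { intros E; rewrite E, Cnorm_RtoC, Rabs_R0 in Hge; lra. }
  rewrite RtoC_inv by lra.
  replace ((RtoC (INR n) + p) / (RtoC (INR n) + q)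
             - (RtoC 1 + (p - q) * Cinv (RtoC (INR n))))%C
    with (- ((p - q) * q) / (RtoC (INR n) * (RtoC (INR n) + q)))%C
    by (field; split; assumption).
  rewrite Cnorm_div, Cnorm_opp, !Cnorm_mul, Cnorm_RtoC, Rabs_right
    by (try apply Cmul_neq0; auto; lra).
  set (m := Cnorm (RtoC (INR n) + q)%C) in *.
  assert (Hm : / m <= 2 * / INR n).
  { replace (2 * / INR n) with (/ (INR n / 2)) by (field; lra).
    apply Rinv_le_contravar; lra. }
  replace (Cnorm (p - q)%C * Cnorm q / (INR n * m))
    with (Cnorm (p - q)%C * Cnorm q * / INR n * / m) by (field; lra).
  replace (2 * Cnorm (p - q)%C * Cnorm q * (/ INR n) ^ 2)
    with (Cnorm (p - q)%C * Cnorm q * / INR n * (2 * / INR n)) by ring.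
  apply Rmult_le_compat_l; [|exact Hm].
  assert (0 < / INR n) by (apply Rinv_0_lt_compat; lra).
  assert (0 <= Cnorm (p - q)%C * Cnorm q) by nra; nra.
Qed.

(** This is the ratio (n+1)^z / n^z. With l = ln (1 + 1/n), the error is the quadratic remainder of
    exp at z l plus z (l - 1/n), both O(1/n^2). *)
Lemma asymp1_Rpow_C (z : Cx) : asymp1 (fun n => Rpow_C (1 + / INR n) z) z.
Proof.
  pose proof (Cnorm_ge0 z) as Hz.
  assert (Hp : / (2 * Cnorm z + 2) > 0) by (apply Rinv_0_lt_compat; lra).
  destruct (eventually_inv_INR_le _ Hp) as [N [HN Hh]].
  exists (10 * Cnorm z ^ 2 + Cnorm z), N; split; [nra|split; [exact HN|]].
  intros n Hn; specialize (Hh n Hn); set (h := / INR n) in *.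
  pose proof (ln_1p_bounds h ltac:(lra)) as Hln; set (l := ln (1 + h)) in *.
  assert (Hzh : Cnorm z * h <= 1 / 2).
  { assert ((2 * Cnorm z + 2) * / (2 * Cnorm z + 2) = 1) by (field; lra); nra. }
  assert (Hl0 : 0 <= l).
  { unfold l; rewrite <- ln_1; left; apply ln_increasing; lra. }
  assert (Hw : Cnorm (z * RtoC l)%C <= Cnorm z * h).
  { rewrite Cnorm_mul, Cnorm_RtoC, Rabs_right by lra; nra. }
  unfold Rpow_C; fold l.
  replace (Cexp (z * RtoC l) - (RtoC 1 + z * RtoC h))%C
    with ((Cexp (z * RtoC l) - (RtoC 1 + z * RtoC l)) + z * RtoC (l - h))%C
    by (rewrite RtoC_sub; ring).
  eapply Rle_trans; [apply Cnorm_triangle|].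
  pose proof (Cexp_sub_linear_bound (z * RtoC l)%C ltac:(lra)) as He.
  rewrite (Cnorm_mul z (RtoC (l - h))), Cnorm_RtoC, Rabs_left1 by lra.
  pose proof (Cnorm_ge0 (z * RtoC l)%C).
  assert (Cnorm (z * RtoC l)%C ^ 2 <= (Cnorm z * h) ^ 2) by (apply pow_incr; lra).
  nra.
Qed.

(** The infinite product of factors 1 + O(1/n^2) converges. Boundedness of [u] comes first; then the
    increments (r_n - 1) u_n are O(1/n^2) and telescope. *)
Lemma asymp1_0_product_cv (u r : nat -> Cx) (N0 : nat) :
  asymp1 r (RtoC 0) -> (forall n, (n >= N0)%nat -> u (S n) = (r n * u n)%C) ->
  exists l, Ccv u l.
Proof.
  intros [C [N1 [HC [HN1 Hr]]]] Hu; set (N := Nat.max N0 N1).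
  assert (Hr1 : forall n, (n >= N)%nat -> Cnorm (r n - RtoC 1)%C <= C * (/ INR n) ^ 2).
  { intros n Hn; specialize (Hr n ltac:(lia)).
    replace (r n - RtoC 1)%C with (r n - (RtoC 1 + RtoC 0 * RtoC (/ INR n)))%C by ring.
    exact Hr. }
  assert (Htel : forall n, (n >= N)%nat ->
            C * (/ INR n) ^ 2 <= 2 * C * / INR n - 2 * C * / INR (S n)).
  { intros n Hn; pose proof (inv_INR_sq_le_telescope n ltac:(lia)); nra. }
  set (M := Cnorm (u N) * exp (2 * C * / INR N)).
  assert (HM0 : 0 <= M)
    by (apply Rmult_le_pos; [apply Cnorm_ge0|left; apply exp_pos]).
  (* The decaying exponent closes the induction: |r_n| <= 1 + C/n^2 <= exp (2C/n - 2C/(n+1)). *)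
  assert (HM : forall n, (n >= N)%nat -> Cnorm (u n) <= M * exp (- (2 * C * / INR n))).
  { intros n Hn; induction Hn as [|n Hn IH].
    - unfold M; rewrite Rmult_assoc, <- exp_plus, Rplus_opp_r, exp_0; lra.
    - rewrite Hu, Cnorm_mul by lia.
      assert (Hrn : Cnorm (r n) <= exp (2 * C * / INR n - 2 * C * / INR (S n))).
      { eapply Rle_trans; [|apply exp_ineq1_le].
        pose proof (Cnorm_triangle_rev (r n) (RtoC 1)) as H.
        rewrite Cnorm_RtoC, Rabs_R1 in H.
        specialize (Hr1 n Hn); specialize (Htel n Hn); lra. }
      replace (- (2 * C * / INR (S n)))
        with ((2 * C * / INR n - 2 * C * / INR (S n)) + - (2 * C * / INR n)) by ring.
      rewrite exp_plus, <- Rmult_assoc, (Rmult_comm M), Rmult_assoc.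
      apply Rmult_le_compat; auto using Cnorm_ge0. }
  assert (Hinv : forall n, (n >= N)%nat -> 0 < / INR n)
    by (intros n Hn; apply inv_INR_bounds; lia).
  assert (HM1 : forall n, (n >= N)%nat -> Cnorm (u n) <= M).
  { intros n Hn; eapply Rle_trans; [apply HM, Hn|].
    rewrite <- (Rmult_1_r M) at 2; apply Rmult_le_compat_l; [exact HM0|].
    rewrite <- exp_0; apply exp_le_compat; specialize (Hinv n Hn); nra. }
  apply Ccv_of_telescoping_bound with (b := fun n => M * (2 * C * / INR n)) (N := N).
  - intros n Hn; specialize (Hinv n Hn).
    apply Rmult_le_pos; [exact HM0|]; nra.
  - intros n Hn; rewrite Hu by lia.
    replace (r n * u n - u n)%C with ((r n - RtoC 1) * u n)%C by ring.
    rewrite Cnorm_mul; specialize (Hr1 n Hn); specialize (HM1 n Hn); specialize (Htel n Hn).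
    pose proof (Cnorm_ge0 (r n - RtoC 1)%C); pose proof (Cnorm_ge0 (u n)); nra.
Qed.

(** To first order |1 + alpha h| is 1 - d h with d = -Re alpha > 0, whereas |r_n - 1| = O(h). The
    second estimate says that r_n approaches 1 inside a Stolz angle, which controls variation by
    decrease of modulus. *)
Lemma asymp1_ratio_bounds (r : nat -> Cx) (alpha : Cx) :
  asymp1 r alpha -> Re alpha < 0 ->
  exists (eps K : R) (N : nat), 0 < eps /\ 0 <= K /\ (1 <= N)%nat /\
    forall n, (n >= N)%nat ->
      Cnorm (r n) <= 1 - eps * / INR n /\
      Cnorm (r n - RtoC 1)%C <= K * (1 - Cnorm (r n)).
Proof.
  intros [C [N1 [HC [HN1 Hr]]]] Ha.
  set (d := - Re alpha); assert (Hd : 0 < d) by (unfold d; lra).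
  set (I2 := Im alpha ^ 2); assert (HI : 0 <= I2) by (unfold I2; nra).
  pose proof (Cnorm_ge0 alpha) as Hna.
  (* The two thresholds ensure d h <= 1/2 and (I2 + C) h <= d/2; the latter lets the quadratic
     errors consume only half of the gain d h. *)
  assert (Hp1 : / (2 * d) > 0) by (apply Rinv_0_lt_compat; lra).
  assert (Hp2 : d / 2 * / (I2 + C + 1) > 0)
    by (apply Rmult_lt_0_compat; [lra|apply Rinv_0_lt_compat; lra]).
  destruct (eventually_inv_INR_le _ Hp1) as [N2 [HN2 Hh1]].
  destruct (eventually_inv_INR_le _ Hp2) as [N3 [HN3 Hh2]].
  exists (d / 2), (2 * (Cnorm alpha + C) / d), (Nat.max N1 (Nat.max N2 N3)).
  split; [lra|split].
  { apply Rmult_le_pos; [lra|left; apply Rinv_0_lt_compat; lra]. }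
  split; [lia|]; intros n Hn.
  specialize (Hr n ltac:(lia)); specialize (Hh1 n ltac:(lia)); specialize (Hh2 n ltac:(lia)).
  destruct (inv_INR_bounds n ltac:(lia)) as [Hh0 Hhle].
  set (h := / INR n) in *.
  assert (Hdh : d * h <= 1 / 2).
  { assert (d * / (2 * d) = 1 / 2) by (field; lra); nra. }
  assert (Hq : (I2 + C) * h <= d / 2).
  { assert ((I2 + C + 1) * (d / 2 * / (I2 + C + 1)) = d / 2) by (field; lra); nra. }
  assert (H1 : Cnorm (RtoC 1 + alpha * RtoC h)%C <= 1 - d * h + I2 * h ^ 2).
  { pose proof (Cnorm_sq (RtoC 1 + alpha * RtoC h)%C) as Hsq.
    pose proof (Cnorm_ge0 (RtoC 1 + alpha * RtoC h)%C) as H0.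
    set (m := Cnorm (RtoC 1 + alpha * RtoC h)%C) in *.
    assert (Em : m * m = (1 - d * h) ^ 2 + I2 * h ^ 2)
      by (rewrite Hsq; unfold d, I2; simpl; ring).
    assert (0 <= I2 * h ^ 2) by (apply Rmult_le_pos; [exact HI|apply pow2_ge_0]).
    assert (HA : 1 - d * h >= 1 / 2) by lra.
    revert Em HA H; generalize (1 - d * h) (I2 * h ^ 2); intros A B Em HA HB.
    assert (0 <= (A - 1 / 2) * B) by (apply Rmult_le_pos; lra).
    assert (m * m <= (A + B) * (A + B)) by (rewrite Em; clear - H HB; nra).
    (* The square root is avoided: m^2 = A^2 + B <= (A + B)^2 because 2 A >= 1. *)
    clear - H0 H1 HA HB; nra. }
  assert (H2 : Cnorm (r n) <= 1 - d / 2 * h).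
  { pose proof (Cnorm_triangle_rev (r n) (RtoC 1 + alpha * RtoC h)%C) as H; nra. }
  split; [exact H2|].
  assert (H3 : Cnorm (r n - RtoC 1)%C <= (Cnorm alpha + C) * h).
  { replace (r n - RtoC 1)%C
      with ((r n - (RtoC 1 + alpha * RtoC h)) + alpha * RtoC h)%C by ring.
    eapply Rle_trans; [apply Cnorm_triangle|].
    rewrite Cnorm_mul, Cnorm_RtoC, (Rabs_right h) by lra.
    assert (C * h ^ 2 <= C * h) by (apply Rmult_le_compat_l; nra); lra. }
  eapply Rle_trans; [exact H3|].
  replace ((Cnorm alpha + C) * h) with (2 * (Cnorm alpha + C) / d * (d / 2 * h)) by (field; lra).
  apply Rmult_le_compat_l; [|lra].
  apply Rmult_le_pos; [lra|left; apply Rinv_0_lt_compat; lra].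
Qed.

(** Since |r_n| <= 1 - eps/n <= exp (eps (ln n - ln (n+1))), the terms are O(n^(-eps)). Multiplying
    the Stolz estimate by |t_n| bounds the variation. *)
Lemma asymp1_decay (t r : nat -> Cx) (alpha : Cx) (N0 : nat) :
  asymp1 r alpha -> Re alpha < 0 ->
  (forall n, (n >= N0)%nat -> t (S n) = (r n * t n)%C) ->
  Ccv t (RtoC 0) /\
  exists (K : R) (N : nat), 0 <= K /\ forall n, (n >= N)%nat ->
    Cnorm (t (S n) - t n)%C <= K * Cnorm (t n) - K * Cnorm (t (S n)).
Proof.
  intros Hr Ha Ht; destruct (asymp1_ratio_bounds r alpha Hr Ha)
    as [eps [K [N1 [He [HK [HN1 Hb]]]]]].
  set (N := Nat.max N0 N1); split.
  - set (M := Cnorm (t N) * exp (eps * ln (INR N))).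
    assert (HM0 : 0 <= M)
      by (apply Rmult_le_pos; [apply Cnorm_ge0|left; apply exp_pos]).
    assert (HM : forall n, (n >= N)%nat -> Cnorm (t n) <= M * exp (- (eps * ln (INR n)))).
    { intros n Hn; induction Hn as [|n Hn IH].
      - unfold M; rewrite Rmult_assoc, <- exp_plus, Rplus_opp_r, exp_0; lra.
      - rewrite Ht, Cnorm_mul by lia.
        assert (Hn1 : 1 <= INR n) by (apply (le_INR 1); lia).
        assert (Hln : ln (INR (S n)) - ln (INR n) <= / INR n).
        { destruct (ln_1p_bounds (/ INR n)) as [_ H]; [apply Rinv_0_lt_compat; lra|].
          replace (ln (INR (S n))) with (ln (INR n * (1 + / INR n))).
          - rewrite ln_mult; [lra|lra|].
            assert (0 < / INR n) by (apply Rinv_0_lt_compat; lra); lra.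
          - f_equal; rewrite S_INR; field; lra. }
        assert (Hrn : Cnorm (r n) <= exp (eps * ln (INR n) - eps * ln (INR (S n)))).
        { eapply Rle_trans; [|apply exp_ineq1_le].
          destruct (Hb n ltac:(lia)) as [H _]; nra. }
        replace (- (eps * ln (INR (S n))))
          with ((eps * ln (INR n) - eps * ln (INR (S n))) + - (eps * ln (INR n))) by ring.
        rewrite exp_plus, <- Rmult_assoc, (Rmult_comm M), Rmult_assoc.
        apply Rmult_le_compat; auto using Cnorm_ge0. }
    intros e Hpos.
    (* [M + 1] replaces [M], which may vanish; [N2] then solves n^(-eps) < e / (M + 1). *)
    assert (He' : 0 < e / (M + 1)) by (apply Rdiv_lt_0_compat; lra).
    destruct (INR_unbounded (exp (- ln (e / (M + 1)) / eps))) as [N2 HN2].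
    exists (Nat.max N N2); intros n Hn.
    replace (t n - RtoC 0)%C with (t n) by ring.
    eapply Rle_lt_trans; [apply HM; lia|].
    assert (INR N2 <= INR n) by (apply le_INR; lia).
    pose proof (exp_pos (- ln (e / (M + 1)) / eps)).
    assert (Hl : - ln (e / (M + 1)) / eps < ln (INR n)).
    { rewrite <- (ln_exp (- ln (e / (M + 1)) / eps)); apply ln_increasing; lra. }
    assert (Hl2 : - ln (e / (M + 1)) < eps * ln (INR n)).
    { replace (- ln (e / (M + 1))) with (eps * (- ln (e / (M + 1)) / eps)) by (field; lra).
      apply Rmult_lt_compat_l; assumption. }
    assert (Hx : exp (- (eps * ln (INR n))) < e / (M + 1)).
    { rewrite <- (exp_ln (e / (M + 1))) by exact He'; apply exp_increasing; lra. }
    pose proof (exp_pos (- (eps * ln (INR n)))).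
    assert ((M + 1) * (e / (M + 1)) = e) by (field; lra); nra.
  - exists K, N; split; [exact HK|]; intros n Hn.
    rewrite Ht by lia.
    replace (r n * t n - t n)%C with ((r n - RtoC 1) * t n)%C by ring.
    rewrite !Cnorm_mul; destruct (Hb n ltac:(lia)) as [_ H].
    pose proof (Cnorm_ge0 (t n)); nra.
Qed.

(** * Pochhammer symbols, Gauss products and Gamma *)

Lemma RtoC_INR_add (m n : nat) : RtoC (INR (m + n)) = (RtoC (INR m) + RtoC (INR n))%C.
Proof. rewrite plus_INR; apply RtoC_add. Qed.

Lemma INR_add_neq0 (z : Cx) (n : nat) : ~ in_Z0m z -> (RtoC (INR n) + z)%C <> RtoC 0.
Proof.
  intros Hz E; apply Hz; exists n; rewrite RtoC_opp.
  replace z with (RtoC (INR n) + z - RtoC (INR n))%C by ring; rewrite E; ring.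
Qed.

Lemma INR_add_1_neq0 (z : Cx) (n : nat) : ~ in_Z0m z ->
  (RtoC (INR n) + (RtoC 1 + z))%C <> RtoC 0.
Proof.
  intros Hz; replace (RtoC (INR n) + (RtoC 1 + z))%C with (RtoC (INR (S n)) + z)%C
    by (rewrite RtoC_INR_S; ring).
  apply INR_add_neq0, Hz.
Qed.

Lemma not_Z0m_neq0 (z : Cx) : ~ in_Z0m z -> z <> RtoC 0.
Proof.
  intros Hz; pose proof (INR_add_neq0 z 0 Hz) as H; intros E; apply H; rewrite E; simpl; ring.
Qed.

Lemma poch_neq0 (z : Cx) (n : nat) : ~ in_Z0m z -> poch z n <> RtoC 0.
Proof.
  intros Hz; induction n as [|n IH]; simpl poch.
  - apply RtoC_neq0; lra.
  - apply Cmul_neq0; [exact IH|].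
    replace (z + RtoC (INR n))%C with (RtoC (INR n) + z)%C by ring; apply INR_add_neq0, Hz.
Qed.

Lemma fact_neq0 (n : nat) : RtoC (INR (fact n)) <> RtoC 0.
Proof. apply RtoC_neq0, INR_fact_neq_0. Qed.

Lemma RtoC_fact_S (n : nat) :
  RtoC (INR (fact (S n))) = ((RtoC (INR n) + RtoC 1) * RtoC (INR (fact n)))%C.
Proof.
  change (fact (S n)) with (S n * fact n)%nat.
  rewrite mult_INR, RtoC_mul, RtoC_INR_S; reflexivity.
Qed.

Lemma RtoC_INR_S_neq0 (n : nat) : (RtoC (INR n) + RtoC 1)%C <> RtoC 0.
Proof. rewrite <- RtoC_INR_S; apply RtoC_neq0, not_0_INR; lia. Qed.

(** Both sides are (z)_(n+1). This collapses each quotient (s)_n / (1+s)_n to s / (n + s). *)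
Lemma poch_shift (z : Cx) (n : nat) :
  (poch (RtoC 1 + z) n * z)%C = (poch z n * (RtoC (INR n) + z))%C.
Proof.
  induction n as [|n IH]; [simpl; ring|]; simpl poch; rewrite RtoC_INR_S.
  transitivity ((poch (RtoC 1 + z) n * z) * (RtoC 1 + z + RtoC (INR n)))%C; [ring|].
  rewrite IH; ring.
Qed.

Lemma asymp1_cv (u : nat -> Cx) (alpha : Cx) : asymp1 u alpha -> Ccv u (RtoC 1).
Proof.
  intros [C [N1 [HC [HN1 Hu]]]] e He; pose proof (Cnorm_ge0 alpha) as Ha.
  assert (Hp : e * / (2 * (C + Cnorm alpha + 1)) > 0)
    by (apply Rmult_lt_0_compat; [lra|apply Rinv_0_lt_compat; lra]).
  destruct (eventually_inv_INR_le _ Hp) as [N2 [HN2 Hh]].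
  exists (Nat.max N1 N2); intros n Hn.
  specialize (Hu n ltac:(lia)); specialize (Hh n ltac:(lia)).
  destruct (inv_INR_bounds n ltac:(lia)) as [Hh0 Hh1]; set (h := / INR n) in *.
  replace (u n - RtoC 1)%C
    with ((u n - (RtoC 1 + alpha * RtoC h)) + alpha * RtoC h)%C by ring.
  eapply Rle_lt_trans; [apply Cnorm_triangle|].
  rewrite Cnorm_mul, Cnorm_RtoC, (Rabs_right h) by lra.
  assert (C * h ^ 2 <= C * h) by (apply Rmult_le_compat_l; nra).
  assert ((C + Cnorm alpha + 1) * (e * / (2 * (C + Cnorm alpha + 1))) = e / 2) by (field; lra).
  nra.
Qed.

Lemma Rpow_C_succ (n : nat) (z : Cx) : (1 <= n)%nat ->
  Rpow_C (INR (S n)) z = (Rpow_C (1 + / INR n) z * Rpow_C (INR n) z)%C.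
Proof.
  intros Hn; assert (1 <= INR n) by (apply (le_INR 1); lia).
  assert (0 < / INR n) by (apply Rinv_0_lt_compat; lra).
  rewrite <- Rpow_C_mult by lra; f_equal; rewrite S_INR; field; lra.
Qed.

Lemma Gamma_seq_neq0 (z : Cx) (n : nat) : ~ in_Z0m z -> Gamma_seq z n <> RtoC 0.
Proof.
  intros Hz; apply Cmul_neq0_l with (w := poch z (S n)); unfold Gamma_seq.
  replace (_ / _ * _)%C with (RtoC (INR (fact n)) * Rpow_C (INR n) z)%C
    by (field; apply poch_neq0, Hz).
  apply Cmul_neq0; [apply fact_neq0|apply Rpow_C_neq0].
Qed.

Lemma Gamma_seq_succ (z : Cx) (n : nat) : ~ in_Z0m z -> (1 <= n)%nat ->
  Gamma_seq z (S n)
  = ((RtoC (INR n) + RtoC 1) / (RtoC (INR n) + (RtoC 1 + z))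
     * Rpow_C (1 + / INR n) z * Gamma_seq z n)%C.
Proof.
  intros Hz Hn; unfold Gamma_seq; rewrite Rpow_C_succ, RtoC_fact_S by assumption.
  change (poch z (S (S n))) with (poch z (S n) * (z + RtoC (INR (S n))))%C.
  rewrite RtoC_INR_S; field; split; [apply poch_neq0, Hz|].
  apply INR_add_1_neq0, Hz.
Qed.

(** In the ratio of consecutive Gauss products, (n+1)/(n+1+z) has exponent -z and (1+1/n)^z has
    exponent z. They cancel, so the limit exists and the default branch of [Gamma] is excluded. *)
Lemma Gamma_spec (z : Cx) : ~ in_Z0m z -> Ccv (Gamma_seq z) (Gamma z).
Proof.
  intros Hz; assert (H : exists g, Ccv (Gamma_seq z) g).
  { eapply asymp1_0_product_cv with (N0 := 1%nat);
      [|intros n Hn; apply Gamma_seq_succ; assumption].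
    replace (RtoC 0) with (RtoC 1 - (RtoC 1 + z) + z)%C by ring.
    apply asymp1_mul; [apply asymp1_frac|apply asymp1_Rpow_C]. }
  unfold Gamma; destruct (excluded_middle_informative _) as [H'|H']; [|contradiction].
  apply proj2_sig.
Qed.

(* The reciprocals of the Gauss products converge by the same argument. *)
Lemma Gamma_seq_inv_cv (z : Cx) : ~ in_Z0m z ->
  Gamma z <> RtoC 0 /\ Ccv (fun n => RtoC 1 / Gamma_seq z n)%C (RtoC 1 / Gamma z)%C.
Proof.
  intros Hz.
  assert (H : exists g, Ccv (fun n => RtoC 1 / Gamma_seq z n)%C g).
  { eapply asymp1_0_product_cv with (N0 := 1%nat)
      (r := fun n => ((RtoC (INR n) + (RtoC 1 + z)) / (RtoC (INR n) + RtoC 1)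
                      * Rpow_C (1 + / INR n) (- z))%C).
    - replace (RtoC 0) with (RtoC 1 + z - RtoC 1 + - z)%C by ring.
      apply asymp1_mul; [apply asymp1_frac|apply asymp1_Rpow_C].
    - intros n Hn; rewrite Gamma_seq_succ, Rpow_C_opp by assumption.
      field; repeat split; try apply Rpow_C_neq0; try (apply Gamma_seq_neq0, Hz);
        try apply RtoC_INR_S_neq0.
      apply INR_add_1_neq0, Hz. }
  destruct H as [g Hg].
  assert (E : (Gamma z * g)%C = RtoC 1).
  { eapply Ccv_unique; [apply (Ccv_mul _ _ _ _ (Gamma_spec z Hz) Hg)|].
    apply Ccv_ext with (u := fun _ => RtoC 1) (N := O); [|apply Ccv_const].
    intros n _; field; apply Gamma_seq_neq0, Hz. }
  assert (H0 : Gamma z <> RtoC 0)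
    by (apply Cmul_neq0_l with (w := g); rewrite E; apply RtoC_neq0; lra).
  split; [exact H0|].
  replace (RtoC 1 / Gamma z)%C with g; [exact Hg|].
  rewrite <- E; field; exact H0.
Qed.

(** * Finite sums and alternating series *)

Lemma Csum_ext (f g : nat -> Cx) (N : nat) :
  (forall n, (n <= N)%nat -> f n = g n) -> Csum f N = Csum g N.
Proof.
  induction N as [|N IH]; intros H; simpl; [apply H; lia|].
  rewrite IH by (intros; apply H; lia); rewrite H by lia; reflexivity.
Qed.

Lemma Csum_mul_l (k : Cx) (f : nat -> Cx) (N : nat) :
  Csum (fun n => k * f n)%C N = (k * Csum f N)%C.
Proof. induction N as [|N IH]; simpl; [reflexivity|]; rewrite IH; ring. Qed.

Lemma Csum_sub (f g : nat -> Cx) (N : nat) :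
  Csum (fun n => f n - g n)%C N = (Csum f N - Csum g N)%C.
Proof. induction N as [|N IH]; simpl; [reflexivity|]; rewrite IH; ring. Qed.

Lemma Cpow_neg1_norm (n : nat) : Cnorm ((- RtoC 1) ^ n)%C = 1.
Proof.
  induction n as [|n IH]; simpl Cpow; rewrite ?Cnorm_mul, ?Cnorm_opp, ?IH, Cnorm_RtoC, Rabs_R1;
    ring.
Qed.

Lemma RtoC_2 : RtoC 2 = (RtoC 1 + RtoC 1)%C.
Proof. rewrite <- RtoC_add; f_equal; ring. Qed.

Lemma RtoC_2_neq0 : (RtoC 1 + RtoC 1)%C <> RtoC 0.
Proof. rewrite <- RtoC_2; apply RtoC_neq0; lra. Qed.

(** Leibniz' criterion for complex terms: monotonicity is replaced by a variation bounded through
    the decrease of |t_n|. *)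
Lemma alternating_cv (t : nat -> Cx) (K : R) (N : nat) :
  0 <= K -> Ccv t (RtoC 0) ->
  (forall n, (n >= N)%nat -> Cnorm (t (S n) - t n)%C <= K * Cnorm (t n) - K * Cnorm (t (S n))) ->
  exists S, Ccv (Csum (fun n => (- RtoC 1) ^ n * t n)%C) S.
Proof.
  intros HK Ht Hd.
  set (half := (RtoC 1 / (RtoC 1 + RtoC 1))%C).
  assert (Hhalf : (half + half)%C = RtoC 1) by (unfold half; field; apply RtoC_2_neq0).
  (* Averaging consecutive partial sums turns the increments into differences of [t]. *)
  set (U := fun n => (Csum (fun n => (- RtoC 1) ^ n * t n) n - half * ((- RtoC 1) ^ n * t n))%C).
  assert (HU : exists l, Ccv U l).
  { apply Ccv_of_telescoping_bound with (b := fun n => Cnorm half * (K * Cnorm (t n))) (N := N).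
    - intros n _; apply Rmult_le_pos; [apply Cnorm_ge0|].
      apply Rmult_le_pos; [exact HK|apply Cnorm_ge0].
    - intros n Hn; rewrite <- Rmult_minus_distr_l.
      replace (U (S n) - U n)%C with (half * ((- RtoC 1) ^ S n * (t (S n) - t n)))%C.
      + rewrite !Cnorm_mul, Cpow_neg1_norm, Rmult_1_l.
        apply Rmult_le_compat_l; [apply Cnorm_ge0|apply Hd, Hn].
      + unfold U; simpl.
        transitivity ((half + half) * ((- RtoC 1) * (- RtoC 1) ^ n * t (S n))
                      - half * ((- RtoC 1) * (- RtoC 1) ^ n * t (S n))
                      + half * ((- RtoC 1) ^ n * t n))%C; [ring|].
        rewrite Hhalf; ring. }
  destruct HU as [l Hl]; exists (l + half * RtoC 0)%C.
  apply Ccv_ext with (u := fun n => (U n + half * ((- RtoC 1) ^ n * t n))%C) (N := O).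
  - intros n _; unfold U; ring.
  - apply Ccv_add; [exact Hl|]; apply Ccv_mul; [apply Ccv_const|].
    intros e He; destruct (Ht e He) as [M HM]; exists M; intros n Hn.
    specialize (HM n Hn).
    replace ((- RtoC 1) ^ n * t n - RtoC 0)%C with ((- RtoC 1) ^ n * (t n - RtoC 0))%C by ring.
    rewrite Cnorm_mul, Cpow_neg1_norm, Rmult_1_l; exact HM.
Qed.

(** * The summation factors and Toeplitz' theorem *)

(* [kappa v N n] is [(-1)^n (-N)_n / (1+v+N)_n]. *)
Fixpoint kappa (v : Cx) (N n : nat) : Cx :=
  match n with
  | O => RtoC 1
  | S m => (kappa v N m * ((RtoC (INR N) - RtoC (INR m)) / (RtoC (INR (S N + m)) + v)))%C
  end.

Lemma kappa_cv (v : Cx) (n : nat) : Ccv (fun N => kappa v N n) (RtoC 1).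
Proof.
  induction n as [|n IH]; [exact (Ccv_const (RtoC 1))|].
  replace (RtoC 1) with (RtoC 1 * RtoC 1)%C by ring.
  change (Ccv (fun N => kappa v N n
    * ((RtoC (INR N) - RtoC (INR n)) / (RtoC (INR (S N + n)) + v)))%C (RtoC 1 * RtoC 1)%C).
  apply Ccv_mul; [exact IH|].
  eapply Ccv_ext with (N := O);
    [|eapply asymp1_cv, (asymp1_frac (- RtoC (INR n))%C (RtoC 1 + RtoC (INR n) + v)%C)].
  intros N _; cbv beta.
  rewrite RtoC_INR_add, RtoC_INR_S; f_equal; ring.
Qed.

(** It kills the boundary term when the sum up to N is summed by parts. *)
Lemma kappa_end (v : Cx) (N : nat) : kappa v N (S N) = RtoC 0.
Proof.
  simpl; unfold Cdiv; replace (RtoC (INR N) - RtoC (INR N))%C with (RtoC 0) by ring; ring.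
Qed.

(** The factor from n to n + 1 is (N - n)/D with D = N + 1 + n + v. The difference D - (N - n) has
    real part 1 + 2n + Re v <= |D| - (N - n) and imaginary part Im v; as |D| - (N - n) >= 1, its
    modulus is at most (1 + |Im v|)(|D| - (N - n)). The constants depend on v only, hence uniformity
    in [N]. *)
Lemma kappa_variation (v : Cx) : ~ in_Z0m v ->
  exists (K : R) (M : nat), 0 <= K /\ forall N n, (M <= n <= N)%nat ->
    Cnorm (kappa v N n - kappa v N (S n))%C
    <= K * Cnorm (kappa v N n) - K * Cnorm (kappa v N (S n)).
Proof.
  (* From [M] on, n + Re v >= 0, which makes 1 + 2n + Re v at least 1. *)
  intros Hv; destruct (INR_unbounded (Rabs (Re v))) as [M HM].
  exists (1 + Rabs (Im v)), M; pose proof (Rabs_pos (Im v)) as HI.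
  split; [lra|]; intros N n Hn.
  pose proof (INR_add_neq0 v (S N + n) Hv) as HD.
  set (D := (RtoC (INR (S N + n)) + v)%C) in *.
  assert (HDr : Re D = INR N + 1 + INR n + Re v).
  { unfold D; rewrite plus_INR, S_INR; reflexivity. }
  assert (INR M <= INR n) by (apply le_INR; lia).
  assert (INR n <= INR N) by (apply le_INR; lia).
  assert (Hx : - INR n <= Re v) by (revert HM; unfold Rabs; destruct (Rcase_abs (Re v)); lra).
  pose proof (Re_le_Cnorm D) as HDn; pose proof (Cnorm_pos D HD) as HDp.
  change (kappa v N (S n))
    with (kappa v N n * ((RtoC (INR N) - RtoC (INR n)) / D))%C.
  replace (kappa v N n - kappa v N n * ((RtoC (INR N) - RtoC (INR n)) / D))%C
    with (kappa v N n * ((D - (RtoC (INR N) - RtoC (INR n))) / D))%C by (field; exact HD).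
  rewrite !Cnorm_mul, !Cnorm_div, <- RtoC_sub, Cnorm_RtoC,
    (Rabs_right (INR N - INR n)) by (try exact HD; lra).
  assert (H1 : Cnorm (D - RtoC (INR N - INR n))%C
               <= (1 + Rabs (Im v)) * (Cnorm D - (INR N - INR n))).
  { eapply Rle_trans; [apply Cnorm_le_parts|].
    assert (ER : Re (D - RtoC (INR N - INR n))%C = 1 + 2 * INR n + Re v)
      by (simpl; simpl in HDr; lra).
    assert (EI : Im (D - RtoC (INR N - INR n))%C = Im v) by (unfold D; simpl; ring).
    rewrite ER, EI, (Rabs_right (1 + 2 * INR n + Re v)) by (pose proof (pos_INR n); lra).
    pose proof (pos_INR n); nra. }
  pose proof (Cnorm_ge0 (kappa v N n)).
  replace ((1 + Rabs (Im v)) * Cnorm (kappa v N n)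
           - (1 + Rabs (Im v)) * (Cnorm (kappa v N n) * ((INR N - INR n) / Cnorm D)))
    with (Cnorm (kappa v N n)
          * (((1 + Rabs (Im v)) * (Cnorm D - (INR N - INR n))) / Cnorm D)) by (field; lra).
  apply Rmult_le_compat_l; [assumption|].
  apply Rmult_le_compat_r; [left; apply Rinv_0_lt_compat|]; assumption.
Qed.

(** Abel summation. Subtracting [S0] makes the coefficients of the differences small when [S0] is
    the sum; the isolated [S0] comes from kappa = 1 at n = 0. *)
Lemma Csum_kappa_by_parts (v : Cx) (c : nat -> Cx) (S0 : Cx) (N m : nat) :
  Csum (fun n => c n * kappa v N n)%C m
  = ((Csum c m - S0) * kappa v N (S m)
     + Csum (fun n => (Csum c n - S0) * (kappa v N n - kappa v N (S n))) m + S0)%C.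
Proof.
  induction m as [|m IH].
  - change (kappa v N 0) with (RtoC 1); cbn [Csum]; change (kappa v N 0) with (RtoC 1); ring.
  - cbn [Csum]; rewrite IH; ring.
Qed.

Lemma Csum_cv (f : nat -> nat -> Cx) (l : nat -> Cx) (M : nat) :
  (forall n, Ccv (fun N => f N n) (l n)) -> Ccv (fun N => Csum (f N) M) (Csum l M).
Proof.
  intros H; induction M as [|M IH]; simpl; [apply H|apply Ccv_add; auto].
Qed.

(* Toeplitz: the summation factors tend to 1 and have bounded variation uniformly in [N]. *)
Lemma Csum_kappa_cv (v : Cx) (c : nat -> Cx) (S0 : Cx) :
  ~ in_Z0m v -> Ccv (Csum c) S0 -> Ccv (fun N => Csum (fun n => c n * kappa v N n)%C N) S0.
Proof.
  intros Hv Hc e He; destruct (kappa_variation v Hv) as [K [M0 [HK HV]]].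
  (* For large [N] one has |kappa v N (S M)| <= 2, so the tail beyond [M] is at most 2 K e' <= e/2;
     the head gets the other half. *)
  assert (He' : e / (4 * (K + 1)) > 0) by (apply Rdiv_lt_0_compat; lra).
  set (e' := e / (4 * (K + 1))) in *.
  destruct (Hc e' He') as [M1 HM1]; set (M := Nat.max M0 M1).
  set (f := fun N n => ((Csum c n - S0) * (kappa v N n - kappa v N (S n)))%C).
  assert (Htail : forall N k, (M + k <= N)%nat ->
            Cnorm (Csum (f N) (M + k) - Csum (f N) M)%C
            <= e' * (K * Cnorm (kappa v N (S M)) - K * Cnorm (kappa v N (S (M + k))))).
  { intros N k; induction k as [|k IH]; intros Hk.
    - rewrite Nat.add_0_r; replace (Csum (f N) M - Csum (f N) M)%C with (RtoC 0) by ring.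
      rewrite Cnorm_RtoC, Rabs_R0; lra.
    - rewrite Nat.add_succ_r in *; cbn [Csum].
      replace (Csum (f N) (M + k) + f N (S (M + k)) - Csum (f N) M)%C
        with ((Csum (f N) (M + k) - Csum (f N) M) + f N (S (M + k)))%C by ring.
      eapply Rle_trans; [apply Cnorm_triangle|].
      specialize (IH ltac:(lia)); specialize (HV N (S (M + k)) ltac:(lia)).
      specialize (HM1 (S (M + k)) ltac:(lia)).
      unfold f at 3; rewrite Cnorm_mul.
      pose proof (Cnorm_ge0 (kappa v N (S (M + k)) - kappa v N (S (S (M + k))))%C).
      pose proof (Cnorm_ge0 (Csum c (S (M + k)) - S0)%C).
      assert (Cnorm (Csum c (S (M + k)) - S0)%C
              * Cnorm (kappa v N (S (M + k)) - kappa v N (S (S (M + k))))%C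
              <= e' * (K * Cnorm (kappa v N (S (M + k)))
                       - K * Cnorm (kappa v N (S (S (M + k))))))
        by (apply Rmult_le_compat; lra).
      lra. }
  assert (Hhead : Ccv (fun N => Csum (f N) M) (RtoC 0)).
  { replace (RtoC 0) with (Csum (fun n => (Csum c n - S0) * (RtoC 1 - RtoC 1))%C M).
    - apply Csum_cv; intros n; unfold f; apply Ccv_mul; [apply Ccv_const|].
      apply Ccv_sub; apply kappa_cv.
    - clear; induction M as [|M IH]; cbn [Csum]; [|rewrite IH]; ring. }
  destruct (Hhead (e / 2)) as [N1 HN1]; [lra|].
  destruct (kappa_cv v (S M) 1) as [N2 HN2]; [lra|].
  exists (M + N1 + N2)%nat; intros N HN.
  specialize (HN1 N ltac:(lia)); specialize (HN2 N ltac:(lia)).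
  specialize (Htail N (N - M)%nat ltac:(lia)); replace (M + (N - M))%nat with N in Htail by lia.
  rewrite (Csum_kappa_by_parts v c S0), kappa_end in *; fold (f N).
  rewrite Cnorm_RtoC, Rabs_R0 in Htail.
  replace ((Csum c N - S0) * RtoC 0 + Csum (f N) N + S0 - S0)%C
    with ((Csum (f N) N - Csum (f N) M) + (Csum (f N) M - RtoC 0))%C by ring.
  eapply Rle_lt_trans; [apply Cnorm_triangle|].
  assert (Hk2 : Cnorm (kappa v N (S M)) <= 2).
  { pose proof (Cnorm_triangle_rev (kappa v N (S M)) (RtoC 1)) as H.
    rewrite (Cnorm_RtoC 1), Rabs_R1 in H; lra. }
  assert (e' * (K * Cnorm (kappa v N (S M)) - K * 0) <= e' * (2 * K))
    by (apply Rmult_le_compat_l; nra).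
  assert (e' * (2 * K) <= e / 2).
  { assert (e' * (4 * (K + 1)) = e) by (unfold e'; field; lra); nra. }
  lra.
Qed.

(** * Partial fractions over the nodes n (n + v) *)

Definition node (v : Cx) (n : nat) : Cx := (RtoC (INR n) * (RtoC (INR n) + v))%C.

Fixpoint node_prod (v X : Cx) (N : nat) : Cx :=
  match N with
  | O => (node v 0 + X)%C
  | S M => (node_prod v X M * (node v (S M) + X))%C
  end.

Definition weight (v : Cx) (n : nat) : Cx :=
  ((- RtoC 1) ^ n * poch v n / RtoC (INR (fact n)) * (v + (RtoC (INR n) + RtoC (INR n))))%C.

Lemma node_sub (v : Cx) (m n : nat) :
  (node v m - node v n)%C
  = ((RtoC (INR m) - RtoC (INR n)) * (RtoC (INR (m + n)) + v))%C.
Proof. unfold node; rewrite RtoC_INR_add; ring. Qed.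

Lemma node_sub_neq0 (v : Cx) (m n : nat) : ~ in_Z0m v -> (n < m)%nat ->
  (node v m - node v n)%C <> RtoC 0.
Proof.
  intros Hv Hnm; rewrite node_sub; apply Cmul_neq0; [|apply INR_add_neq0, Hv].
  rewrite <- RtoC_sub; apply RtoC_neq0; apply lt_INR in Hnm; lra.
Qed.

Lemma node_prod_neq0 (v X : Cx) (N : nat) :
  (forall n, (n <= N)%nat -> (node v n + X)%C <> RtoC 0) -> node_prod v X N <> RtoC 0.
Proof.
  induction N as [|N IH]; intros H; cbn [node_prod]; [apply H; lia|].
  apply Cmul_neq0; [apply IH; intros; apply H; lia|apply H; lia].
Qed.

(** The quotient of the kappas for N + 1 and N telescopes to (N+1)(N+1+v) / ((N+1-n)(N+1+n+v)),
    whose denominator is x_(N+1) - x_n. This drives the induction on N for the partial fractions. *)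
Lemma kappa_succ (v : Cx) (N n : nat) : ~ in_Z0m v -> (n <= N)%nat ->
  (kappa v (S N) n * (node v (S N) - node v n))%C
  = (kappa v N n * (RtoC (INR (S N)) * (RtoC (INR (S N)) + v)))%C.
Proof.
  intros Hv; induction n as [|n IH]; intros Hn.
  - cbn [kappa]; unfold node; simpl (INR 0); ring.
  - specialize (IH ltac:(lia)); cbn [kappa]; rewrite node_sub in *.
    assert (Hd : (RtoC (INR (S N)) - RtoC (INR n))%C <> RtoC 0).
    { rewrite <- RtoC_sub; apply RtoC_neq0.
      assert (H : (n < S N)%nat) by lia; apply lt_INR in H; lra. }
    pose proof (INR_add_neq0 v (S N + n) Hv) as H1.
    pose proof (INR_add_neq0 v (S (S N) + n) Hv) as H2.
    set (k := kappa v (S N) n) in *; set (k' := kappa v N n) in *.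
    replace (S N + S n)%nat with (S (S N) + n)%nat by lia.
    replace (k' * ((RtoC (INR N) - RtoC (INR n)) / (RtoC (INR (S N + n)) + v))
             * (RtoC (INR (S N)) * (RtoC (INR (S N)) + v)))%C
      with (k' * (RtoC (INR (S N)) * (RtoC (INR (S N)) + v))
            * ((RtoC (INR N) - RtoC (INR n)) / (RtoC (INR (S N + n)) + v)))%C
      by (field; exact H1).
    rewrite <- IH, (RtoC_INR_S n), !(RtoC_INR_S N).
    rewrite (RtoC_INR_S N) in Hd; field; split; assumption.
Qed.

(* For [j = 0] this evaluates the last factor [kappa v K K]. *)
Lemma kappa_node_prod (v : Cx) (M j : nat) : ~ in_Z0m v ->
  let K := (S M + j)%nat in
  (kappa v K (S M) * node_prod v (- node v K) M * (RtoC (INR (K + S M)) + v)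
   * (RtoC (INR (fact j)) * RtoC (INR (fact j))))%C
  = ((- RtoC 1) ^ S M * (RtoC (INR (fact K)) * RtoC (INR (fact K))) * (RtoC (INR K) + v))%C.
Proof.
  intros Hv; revert j; induction M as [|M IH]; intros j; cbv zeta.
  - cbn [kappa node_prod Cpow].
    pose proof (INR_add_neq0 v (S (1 + j) + 0) Hv) as H1.
    replace (node v 0 + - node v (1 + j))%C with (- (node v (1 + j) - node v 0))%C by ring.
    rewrite node_sub; rewrite !Nat.add_0_r in *.
    replace (1 + j + 1)%nat with (S (1 + j)) by lia.
    change (1 + j)%nat with (S j) in *; rewrite RtoC_fact_S.
    simpl (RtoC (INR 0)); rewrite (RtoC_INR_S j); field; exact H1.
  (* [K] stays fixed: raising [M] by one is compensated by lowering [j] by one. *)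
  - specialize (IH (S j)); cbv zeta in IH.
    replace (S M + S j)%nat with (S (S M) + j)%nat in IH by lia.
    set (K := (S (S M) + j)%nat) in *.
    cbn [node_prod]; change (kappa v K (S (S M)))
      with (kappa v K (S M) * ((RtoC (INR K) - RtoC (INR (S M))) / (RtoC (INR (S K + S M)) + v)))%C.
    replace (node v (S M) + - node v K)%C with (- (node v K - node v (S M)))%C by ring.
    rewrite node_sub.
    pose proof (INR_add_neq0 v (S K + S M) Hv) as H1.
    replace (K + S (S M))%nat with (S K + S M)%nat by lia.
    assert (EK : (RtoC (INR K) - RtoC (INR (S M)))%C = (RtoC (INR j) + RtoC 1)%C).
    { unfold K; replace (S (S M) + j)%nat with (S j + S M)%nat by lia.
      rewrite RtoC_INR_add, RtoC_INR_S; ring. }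
    rewrite EK; rewrite RtoC_fact_S in IH.
    change ((- RtoC 1) ^ S (S M))%C with ((- RtoC 1) * (- RtoC 1) ^ S M)%C.

    transitivity (- RtoC 1 * ((- RtoC 1) ^ S M * (RtoC (INR (fact K)) * RtoC (INR (fact K)))
                              * (RtoC (INR K) + v)))%C; [rewrite <- IH|ring].
    field; exact H1.
Qed.

(** The induction hypothesis is used twice, at X and at -x_(N+1). The second use produces exactly
    the residue at the new pole, so that contribution cancels and only the first use survives, times
    (N+1)(N+1+v) / (x_(N+1) + X). *)
Lemma partial_fractions (v : Cx) (N : nat) (X : Cx) : ~ in_Z0m v ->
  (forall n, (n <= N)%nat -> (node v n + X)%C <> RtoC 0) ->
  Csum (fun n => weight v n / (node v n + X) * kappa v N n)%C N
  = (RtoC (INR (fact N)) * poch v (S N) / node_prod v X N)%C.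
Proof.
  intros Hv; revert X; induction N as [|N IH]; intros X HX.
  - pose proof (HX O (Nat.le_refl _)) as H0.
    cbn [Csum kappa node_prod poch]; unfold weight; cbn [Cpow poch fact].
    change (RtoC (INR 1)) with (RtoC 1); change (RtoC (INR 0)) with (RtoC 0).
    field; split; [exact H0|apply RtoC_neq0; lra].
  - cbn [Csum].
    set (A := (RtoC (INR (S N)) * (RtoC (INR (S N)) + v))%C).
    set (y := (node v (S N) + X)%C).
    assert (Hy : y <> RtoC 0) by (apply HX; lia).
    assert (Hnode : forall n, (n <= N)%nat -> (node v n + - node v (S N))%C <> RtoC 0).
    { intros n Hn E; apply (node_sub_neq0 v (S N) n Hv); [lia|].
      replace (node v (S N) - node v n)%C with (- (node v n + - node v (S N)))%C by ring.
      rewrite E; ring. }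
    assert (HX' : forall n, (n <= N)%nat -> (node v n + X)%C <> RtoC 0)
      by (intros; apply HX; lia).
    pose proof (IH X HX') as I1; pose proof (IH (- node v (S N))%C Hnode) as I2.
    (* By [kappa_succ] each old term acquires the factor A / (x_(N+1) - x_n), and 1 / ((x_n +
       X)(x_(N+1) - x_n)) equals (1 / (x_n + X) - 1 / (x_n - x_(N+1))) / y. *)
    transitivity (A / y * (Csum (fun n => weight v n / (node v n + X) * kappa v N n)%C N
                           - Csum (fun n => weight v n / (node v n + - node v (S N))
                                            * kappa v N n)%C N)
                  + weight v (S N) / y * kappa v (S N) (S N))%C.
    { f_equal; rewrite <- Csum_sub, <- Csum_mul_l; apply Csum_ext; intros n Hn.
      pose proof (kappa_succ v N n Hv Hn) as Hk; fold A in Hk.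
      pose proof (node_sub_neq0 v (S N) n Hv ltac:(lia)) as Hd.
      replace (kappa v (S N) n) with (kappa v N n * A / (node v (S N) - node v n))%C
        by (rewrite <- Hk; field; exact Hd).
      specialize (Hnode n Hn); specialize (HX' n Hn).
      unfold y in *; field; repeat split; assumption. }
    rewrite I1, I2; cbn [node_prod]; fold y.
    pose proof (node_prod_neq0 v X N HX') as HQ.
    pose proof (node_prod_neq0 v (- node v (S N))%C N Hnode) as HQ'.
    pose proof (kappa_node_prod v N 0 Hv) as Hd; cbv zeta in Hd.
    rewrite Nat.add_0_r in Hd; change (fact 0) with 1%nat in Hd.
    change (RtoC (INR 1)) with (RtoC 1) in Hd.
    set (Q' := node_prod v (- node v (S N))%C N) in *; set (Q := node_prod v X N) in *.
    pose proof (INR_add_neq0 v (S N + S N) Hv) as H2.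
    set (k := kappa v (S N) (S N)) in *.
    assert (Hs : ((- RtoC 1) ^ S N * (- RtoC 1) ^ S N)%C = RtoC 1).
    { generalize (S N); intros m; induction m as [|m IHm]; simpl Cpow; [ring|].
      transitivity ((- RtoC 1) ^ m * (- RtoC 1) ^ m)%C; [ring|exact IHm]. }
    (* The residue of the new term is [A] times the induction hypothesis at -x_(N+1); the two signs
       (-1)^(N+1) multiply to 1. *)
    assert (Hw : (weight v (S N) * k)%C = (A * (RtoC (INR (fact N)) * poch v (S N) / Q'))%C).
    { unfold weight.
      replace k with ((- RtoC 1) ^ S N * (RtoC (INR (fact (S N))) * RtoC (INR (fact (S N))))
                      * (RtoC (INR (S N)) + v) / (Q' * (RtoC (INR (S N + S N)) + v)))%C
        by (rewrite <- Hd; field; split; assumption).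
      rewrite RtoC_INR_add in *.
      transitivity (((- RtoC 1) ^ S N * (- RtoC 1) ^ S N) * poch v (S N)
                    * RtoC (INR (fact (S N))) * (RtoC (INR (S N)) + v) / Q')%C.
      - field; repeat split; try assumption; apply fact_neq0.
      - rewrite Hs, RtoC_fact_S, <- RtoC_INR_S; unfold A; field; exact HQ'. }
    replace (weight v (S N) / y * k)%C with (weight v (S N) * k / y)%C by (field; exact Hy).
    rewrite Hw; change (poch v (S (S N))) with (poch v (S N) * (v + RtoC (INR (S N))))%C.
    rewrite RtoC_fact_S, <- RtoC_INR_S; unfold A; field; repeat split; assumption.
Qed.

(** * Sum of the well-poised series by Gauss products *)

Lemma node_add_mul (s s' : Cx) (n : nat) :
  (node (s + s') n + s * s')%C = ((RtoC (INR n) + s) * (RtoC (INR n) + s'))%C.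
Proof. unfold node; ring. Qed.

Lemma node_prod_poch (s s' : Cx) (N : nat) :
  node_prod (s + s')%C (s * s')%C N = (poch s (S N) * poch s' (S N))%C.
Proof.
  induction N as [|N IH]; cbn [node_prod]; rewrite node_add_mul.
  - cbn [poch]; ring.
  - rewrite IH.
    change (poch s (S (S N))) with (poch s (S N) * (s + RtoC (INR (S N))))%C.
    change (poch s' (S (S N))) with (poch s' (S N) * (s' + RtoC (INR (S N))))%C; ring.
Qed.

(** The powers N^s N^s' and N^(s+s') cancel; this holds at N = 0 too, because [Rpow_C] vanishes for
    no base. *)
Lemma Gamma_seq_beta (s s' : Cx) (N : nat) :
  ~ in_Z0m s -> ~ in_Z0m s' -> ~ in_Z0m (s + s')%C ->
  (RtoC (INR (fact N)) * poch (s + s') (S N) / (poch s (S N) * poch s' (S N)))%C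
  = (Gamma_seq s N * Gamma_seq s' N / Gamma_seq (s + s') N)%C.
Proof.
  intros Hs Hs' Hv; unfold Gamma_seq; rewrite Rpow_C_add.
  field; repeat split; try apply Rpow_C_neq0; try apply fact_neq0; apply poch_neq0; assumption.
Qed.

Lemma Gamma_seq_beta_cv (s s' : Cx) :
  ~ in_Z0m s -> ~ in_Z0m s' -> ~ in_Z0m (s + s')%C ->
  Ccv (fun N => Gamma_seq s N * Gamma_seq s' N / Gamma_seq (s + s') N)%C
      (Gamma s * Gamma s' / Gamma (s + s'))%C.
Proof.
  intros Hs Hs' Hv; destruct (Gamma_seq_inv_cv _ Hv) as [H0 Hinv].
  replace (Gamma s * Gamma s' / Gamma (s + s'))%C
    with (Gamma s * Gamma s' * (RtoC 1 / Gamma (s + s')))%C by (field; exact H0).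
  eapply Ccv_ext with (N := O);
    [|apply Ccv_mul; [apply Ccv_mul; apply Gamma_spec; assumption|exact Hinv]].
  intros N _; cbv beta; field; apply Gamma_seq_neq0, Hv.
Qed.

(** Apart from the sign, the term ratio has exponent (v - 1) + 1 - 4 = v - 4: v - 1 from (v)_n / n!,
    1 from v + 2n, and -1 from each of the four linear factors of the denominator. This is the role
    of Re v < 4. *)
Lemma well_poised_series_cv (v s s' q q' : Cx) :
  (s + s')%C = v -> (q + q')%C = v ->
  ~ in_Z0m s -> ~ in_Z0m s' -> ~ in_Z0m q -> ~ in_Z0m q' ->
  ~ in_Z0m (v / RtoC 2)%C -> Re v < 4 ->
  exists S0, Ccv (Csum (fun n => weight v n
    / ((node v n + s * s') * (node v n + q * q')))%C) S0.
Proof.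
  intros Ev Ev' Hs Hs' Hq Hq' Hv2 Hre.
  (* Writing v + 2n = 2 (n + h) makes its ratio a quotient of shifts of n, with n + h nonzero by the
     hypothesis on v/2. *)
  set (h := (v / RtoC 2)%C) in *.
  assert (Eh : (h + h)%C = v)
    by (unfold h; rewrite RtoC_2; field; apply RtoC_2_neq0).
  set (t := fun n => (poch v n / RtoC (INR (fact n)) * (v + (RtoC (INR n) + RtoC (INR n)))
                      / ((node v n + s * s') * (node v n + q * q')))%C).
  set (g := fun (x : Cx) n =>
              ((RtoC (INR n) + x) / (RtoC (INR n) + (RtoC 1 + x)))%C).
  set (r := fun n => ((RtoC (INR n) + v) / (RtoC (INR n) + RtoC 1)
                      * ((RtoC (INR n) + (RtoC 1 + h)) / (RtoC (INR n) + h))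
                      * (g s n * g s' n * (g q n * g q' n)))%C).
  assert (Hg : forall x, asymp1 (g x) (x - (RtoC 1 + x))%C) by (intros x; apply asymp1_frac).
  destruct (asymp1_decay t r (v - RtoC 4)%C 0) as [Ht [K [N [HK Hd]]]].
  - replace (v - RtoC 4)%C
      with ((v - RtoC 1) + (RtoC 1 + h - h)
            + ((s - (RtoC 1 + s)) + (s' - (RtoC 1 + s'))
               + ((q - (RtoC 1 + q)) + (q' - (RtoC 1 + q')))))%C.
    + apply asymp1_mul; [apply asymp1_mul; apply asymp1_frac|].
      apply asymp1_mul; apply asymp1_mul; apply Hg.
    + replace 4 with (1 + 1 + 1 + 1) by ring; rewrite !RtoC_add; ring.
  - simpl; lra.
  - intros n _; unfold t, r, g.
    assert (HX : forall n, (node v n + s * s')%C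
                           = ((RtoC (INR n) + s) * (RtoC (INR n) + s'))%C)
      by (intros m; rewrite <- Ev; apply node_add_mul).
    assert (HY : forall n, (node v n + q * q')%C
                           = ((RtoC (INR n) + q) * (RtoC (INR n) + q'))%C)
      by (intros m; rewrite <- Ev'; apply node_add_mul).
    rewrite !HX, !HY, RtoC_fact_S, RtoC_INR_S; cbn [poch].
    pose proof (fact_neq0 n) as Hf; pose proof (RtoC_INR_S_neq0 n) as H1.
    pose proof (INR_add_neq0 _ n Hv2) as Hh0.
    pose proof (INR_add_neq0 _ n Hs); pose proof (INR_add_neq0 _ n Hs');
      pose proof (INR_add_neq0 _ n Hq); pose proof (INR_add_neq0 _ n Hq').
    pose proof (INR_add_1_neq0 _ n Hs); pose proof (INR_add_1_neq0 _ n Hs');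
      pose proof (INR_add_1_neq0 _ n Hq); pose proof (INR_add_1_neq0 _ n Hq').
    set (p := poch v n); set (x := RtoC (INR n)) in *; set (f := RtoC (INR (fact n))) in *.
    clearbody p x f h; clear - Eh Hf H1 Hh0 H H0 H2 H3 H4 H5 H6 H7.
    rewrite <- Eh; field.
    repeat match goal with |- _ /\ _ => split end; try assumption;
      match goal with
      | |- (?a + RtoC 1 + ?b)%C <> _ =>
          replace (a + RtoC 1 + b)%C with (a + (RtoC 1 + b))%C by ring; assumption
      end.
  - destruct (alternating_cv t K N HK Ht Hd) as [S0 HS]; exists S0.
    eapply Ccv_ext with (N := O); [|exact HS].
    intros M _; apply Csum_ext; intros n _; unfold t, weight, Cdiv; ring.
Qed.

Lemma well_poised_series_sum (v s s' q q' : Cx) :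
  (s + s')%C = v -> (q + q')%C = v ->
  ~ in_Z0m s -> ~ in_Z0m s' -> ~ in_Z0m q -> ~ in_Z0m q' ->
  ~ in_Z0m v -> ~ in_Z0m (v / RtoC 2)%C -> Re v < 4 -> (q * q' - s * s')%C <> RtoC 0 ->
  Ccv (Csum (fun n => weight v n / ((node v n + s * s') * (node v n + q * q')))%C)
      (RtoC 1 / (q * q' - s * s')
       * (Gamma s * Gamma s' / Gamma v - Gamma q * Gamma q' / Gamma v))%C.
Proof.
  intros Ev Ev' Hs Hs' Hq Hq' Hv Hv2 Hre Hne.
  destruct (well_poised_series_cv v s s' q q') as [S0 HS]; try assumption.
  assert (Hnode : forall y y', (y + y')%C = v -> ~ in_Z0m y -> ~ in_Z0m y' ->
            forall n, (node v n + y * y')%C <> RtoC 0).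
  { intros y y' <- Hy Hy' n; rewrite node_add_mul.
    apply Cmul_neq0; apply INR_add_neq0; assumption. }
  assert (Hfin : forall y y', (y + y')%C = v -> ~ in_Z0m y -> ~ in_Z0m y' -> forall N,
            Csum (fun n => weight v n / (node v n + y * y') * kappa v N n)%C N
            = (Gamma_seq y N * Gamma_seq y' N / Gamma_seq v N)%C).
  { intros y y' E Hy Hy' N; rewrite partial_fractions by (auto; intros; apply Hnode; auto).
    subst v; rewrite <- E, node_prod_poch; apply Gamma_seq_beta; rewrite ?E; assumption. }
  assert (Hlim : forall y y', (y + y')%C = v -> ~ in_Z0m y -> ~ in_Z0m y' ->
            Ccv (fun N => Gamma_seq y N * Gamma_seq y' N / Gamma_seq v N)%C
                (Gamma y * Gamma y' / Gamma v)%C)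
    by (intros y y' <- Hy Hy'; apply Gamma_seq_beta_cv; assumption).
  (* With the kappas inserted the partial sums still tend to [S0], but now split into two closed
     forms with known limits; uniqueness of the limit identifies [S0]. *)
  pose proof (Csum_kappa_cv v _ _ Hv HS) as HT.
  replace (RtoC 1 / _ * _)%C with S0; [exact HS|].
  eapply Ccv_unique; [exact HT|].
  eapply Ccv_ext with (N := O);
    [|apply Ccv_mul; [apply Ccv_const|apply Ccv_sub; apply Hlim]]; try eassumption.
  intros N _; cbv beta.
  rewrite <- (Hfin s s'), <- (Hfin q q'), <- Csum_sub, <- Csum_mul_l by assumption.
  apply Csum_ext; intros n _.
  pose proof (Hnode s s' Ev Hs Hs' n); pose proof (Hnode q q' Ev' Hq Hq' n).
  field; repeat split; assumption.
Qed.

(** * From the hypergeometric term to the closed formula *)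

Lemma not_Z0m_of_succ (s : Cx) : s <> RtoC 0 -> ~ in_Z0m (RtoC 1 + s)%C -> ~ in_Z0m s.
Proof.
  intros H0 H1 [[|k] E].
  - apply H0; rewrite E; f_equal; simpl; ring.
  - apply H1; exists k; rewrite E, <- RtoC_add; f_equal; rewrite S_INR; ring.
Qed.

(** Each (s)_n / (1+s)_n contributes s / (n + s), and (1+v/2)_n / (v/2)_n contributes (v + 2n) / v,
    whence the prefactor s s' q q' / v. *)
Lemma hyp_term_well_poised (v s s' q q' : Cx) (n : nat) :
  (s + s')%C = v -> (q + q')%C = v ->
  ~ in_Z0m s -> ~ in_Z0m s' -> ~ in_Z0m q -> ~ in_Z0m q' ->
  ~ in_Z0m (RtoC 1 + s)%C -> ~ in_Z0m (RtoC 1 + s')%C ->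
  ~ in_Z0m (RtoC 1 + q)%C -> ~ in_Z0m (RtoC 1 + q')%C ->
  ~ in_Z0m v -> ~ in_Z0m (v / RtoC 2)%C ->
  hyp_term [v; (RtoC 1 + v / RtoC 2)%C; s; s'; q; q']
           [(v / RtoC 2)%C; (RtoC 1 + s)%C; (RtoC 1 + s')%C; (RtoC 1 + q)%C; (RtoC 1 + q')%C]
           (- RtoC 1)%C n
  = (s * s' * q * q' / v
     * (weight v n / ((node v n + s * s') * (node v n + q * q'))))%C.
Proof.
  intros Ev Ev' Hs Hs' Hq Hq' Hs1 Hs1' Hq1 Hq1' Hv Hv2.
  replace (node v n + s * s')%C with ((RtoC (INR n) + s) * (RtoC (INR n) + s'))%C
    by (rewrite <- Ev; symmetry; apply node_add_mul).
  replace (node v n + q * q')%C with ((RtoC (INR n) + q) * (RtoC (INR n) + q'))%C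
    by (rewrite <- Ev'; symmetry; apply node_add_mul).
  unfold hyp_term, weight, Cprod; cbn [map fold_right].
  assert (Hshift : forall x, ~ in_Z0m x -> ~ in_Z0m (RtoC 1 + x)%C ->
            poch x n = (poch (RtoC 1 + x) n * x / (RtoC (INR n) + x))%C).
  { intros x Hx Hx1; rewrite poch_shift; field; apply INR_add_neq0, Hx. }
  assert (Hh : poch (RtoC 1 + v / RtoC 2)%C n
               = (poch (v / RtoC 2)%C n * (v + (RtoC (INR n) + RtoC (INR n))) / v)%C).
  { pose proof (poch_shift (v / RtoC 2)%C n) as E.
    pose proof (not_Z0m_neq0 _ Hv) as H0; pose proof RtoC_2_neq0 as H2.
    set (P := poch (RtoC 1 + v / RtoC 2)%C n) in *; set (Q := poch (v / RtoC 2)%C n) in *.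
    rewrite RtoC_2 in E.
    replace P with (P * (v / (RtoC 1 + RtoC 1)) * (RtoC 1 + RtoC 1) / v)%C
      by (field; split; assumption).
    rewrite E; field; split; assumption. }
  rewrite Hh, (Hshift s), (Hshift s'), (Hshift q), (Hshift q') by assumption.
  field; repeat split; try (apply poch_neq0; assumption); try (apply INR_add_neq0; assumption);
    try apply fact_neq0; apply not_Z0m_neq0; assumption.
Qed.

Theorem mainTheorem1 (v a b c : Cx) :
  a <> RtoC 0 -> b <> RtoC 0 ->
  Re v < 4 -> Re c > 0 ->
  Re (v * c + a + b)%C > 0 -> Re (v * c + a - b)%C > 0 ->
  Re (v * c - a + b)%C > 0 -> Re (v * c - a - b)%C > 0 ->
  let two := RtoC 2 in
  let one := RtoC 1 in
  let s3 := (v / two - a / (two * c) - b / (two * c))%C in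
  let s4 := (v / two - a / (two * c) + b / (two * c))%C in
  let s5 := (v / two + a / (two * c) + b / (two * c))%C in
  let s6 := (v / two + a / (two * c) - b / (two * c))%C in
  let P := ((v * c - a - b) * (v * c + a + b) * (v * c - a + b) * (v * c + a - b))%C in
  ~ in_Z0m (v / two)%C ->
  ~ in_Z0m (one + s3)%C -> ~ in_Z0m (one + s4)%C ->
  ~ in_Z0m (one + s5)%C -> ~ in_Z0m (one + s6)%C ->
  hyp_sum [v; (one + v / two)%C; s3; s5; s4; s6]
          [(v / two)%C; (one + s3)%C; (one + s5)%C; (one + s4)%C; (one + s6)%C]
          (- one)%C
          ((P / (RtoC 16 * v * a * b * (c ^ 2) * Gamma v))
             * (Gamma s5 * Gamma s3 - Gamma s6 * Gamma s4))%C.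
Proof.
  intros Ha Hb Hre Hc R1 R2 R3 R4 two one s3 s4 s5 s6 P Hv2 H3 H4 H5 H6.
  pose proof RtoC_2_neq0 as H2.
  assert (Hc0 : c <> RtoC 0) by (intros E; rewrite E in Hc; simpl in Hc; lra).
  (* Adding [R1] and [R4] gives Re (v c) > 0, impossible for v = -k because Re c > 0. *)
  assert (Hv : ~ in_Z0m v).
  { intros [k Ek]; rewrite Ek in R1, R4; simpl in R1, R4.
    pose proof (pos_INR k); nra. }
  assert (Hpos : forall z, Re z > 0 -> z <> RtoC 0)
    by (intros z Hz E; rewrite E in Hz; simpl in Hz; lra).
  assert (E3 : ((RtoC 1 + RtoC 1) * c * s3)%C = (v * c - a - b)%C)
    by (unfold s3, two; rewrite RtoC_2; field; split; assumption).
  assert (E4 : ((RtoC 1 + RtoC 1) * c * s4)%C = (v * c - a + b)%C)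
    by (unfold s4, two; rewrite RtoC_2; field; split; assumption).
  assert (E5 : ((RtoC 1 + RtoC 1) * c * s5)%C = (v * c + a + b)%C)
    by (unfold s5, two; rewrite RtoC_2; field; split; assumption).
  assert (E6 : ((RtoC 1 + RtoC 1) * c * s6)%C = (v * c + a - b)%C)
    by (unfold s6, two; rewrite RtoC_2; field; split; assumption).
  assert (N3 : ~ in_Z0m s3)
    by (apply not_Z0m_of_succ; [eapply Cmul_neq0_r; rewrite E3; apply Hpos|]; assumption).
  assert (N4 : ~ in_Z0m s4)
    by (apply not_Z0m_of_succ; [eapply Cmul_neq0_r; rewrite E4; apply Hpos|]; assumption).
  assert (N5 : ~ in_Z0m s5)
    by (apply not_Z0m_of_succ; [eapply Cmul_neq0_r; rewrite E5; apply Hpos|]; assumption).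
  assert (N6 : ~ in_Z0m s6)
    by (apply not_Z0m_of_succ; [eapply Cmul_neq0_r; rewrite E6; apply Hpos|]; assumption).
  assert (S35 : (s3 + s5)%C = v)
    by (unfold s3, s5, two; rewrite RtoC_2; field; split; assumption).
  assert (S46 : (s4 + s6)%C = v)
    by (unfold s4, s6, two; rewrite RtoC_2; field; split; assumption).
  assert (Hdiff : (s4 * s6 - s3 * s5)%C = (a * b / (c * c))%C)
    by (unfold s3, s4, s5, s6, two; rewrite RtoC_2; field; split; assumption).
  assert (Hd0 : (s4 * s6 - s3 * s5)%C <> RtoC 0).
  { intros E; apply (Cmul_neq0 a b Ha Hb).
    replace (a * b)%C with (a * b / (c * c) * (c * c))%C by (field; assumption).
    rewrite <- Hdiff, E; ring. }
  pose proof (well_poised_series_sum v s3 s5 s4 s6 S35 S46 N3 N5 N4 N6 Hv Hv2 Hre Hd0) as HS.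
  destruct (Gamma_seq_inv_cv v Hv) as [HG _].
  pose proof (not_Z0m_neq0 v Hv) as Hv0.
  unfold hyp_sum.
  eapply Ccv_ext with (N := O).
  { intros N _; symmetry; etransitivity;
      [apply Csum_ext; intros n _; apply hyp_term_well_poised; assumption|apply Csum_mul_l]. }
  replace (P / (RtoC 16 * v * a * b * c ^ 2 * Gamma v)
           * (Gamma s5 * Gamma s3 - Gamma s6 * Gamma s4))%C
    with (s3 * s5 * s4 * s6 / v
          * (RtoC 1 / (s4 * s6 - s3 * s5)
             * (Gamma s3 * Gamma s5 / Gamma v - Gamma s4 * Gamma s6 / Gamma v)))%C;
    [apply Ccv_mul; [apply Ccv_const|exact HS]|].
  (* Each factor of [P] is 2 c s_j, so P = 16 c^4 s3 s4 s5 s6; dividing by Y - X = a b / c^2 leaves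
     P / (16 v a b c^2). *)
  rewrite Hdiff; unfold P; rewrite <- E3, <- E4, <- E5, <- E6; simpl Cpow.
  replace 16 with (2 * 2 * 2 * 2) by ring; rewrite !RtoC_mul, RtoC_2.
  (* The remaining identity holds for any nonzero [k] in place of 2, with 16 read as k^4. *)
  generalize dependent (RtoC 1 + RtoC 1)%C; intros k Hk _ _ _ _.
  field; repeat split; assumption.
Qed.
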